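(* Let $(S,\mathcal F)$ be a sheaved space with values in $\mathcal V$, let $v\in S$ be a beat element of $(S,\mathcal F)$, and let $S'=S\setminus\{v\}$ with the induced order. Then the canonical inclusion $S'\hookrightarrow S$ induces a natural isomorphism $$H^{j}(S,\mathcal F)\;\cong\; H^{j}(S',\mathcal F|_{S'})\qquad\text{for all } j\ge 0.$$
   Context: $\mathcal V$ is an abelian category with enough injectives (e.g. abelian groups, or vector spaces over a field). For a finite poset $S$, $X_S$ denotes $S$ with the Alexandrov topology, whose open sets are the upper sets. Sheaves on $X_S$ with values in $\mathcal V$ are equivalent to, and identified with, functors $\mathcal F: S\to\mathcal V$ (an object $\mathcal F(s)$ for each $s\in S$ and compatible restriction morphisms $\mathrm{res}^{s}_{t}:\mathcal F(s)\to\mathcal F(t)$ for $s\le t$). A sheaved space is a pair $(S,\mathcal F)$ with $S$ a finite poset and $\mathcal F$ such a sheaf. For $S'\subseteq S$ with the induced order, $\mathcal F|_{S'}$ is the restriction of the functor $\mathcal F$ to $S'$. Global sections are $\Gamma(S,\mathcal F)=\lim_{s\in S}\mathcal F(s)$, and $H^j(S,\mathcal F)=H^j(X_S,\mathcal F)$ is the $j$-th right derived functor of $\Gamma(S,-)$ applied to $\mathcal F$. The inclusion $S'\hookrightarrow S$ induces maps $H^j(S,\mathcal F)\to H^j(S',\mathcal F|_{S'})$ (extending the restriction map $\Gamma(S,\mathcal F)\to\Gamma(S',\mathcal F|_{S'})$ in degree $0$ to a map of $\delta$-functors). Beat elements of $(S,\mathcal F)$: an element $s\in S$ is a downbeat if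 there is $a<s$ such that every $b<s$ satisfies $b\le a$. It is an upbeat if there is $a>s$ such that every $b>s$ satisfies $b\ge a$, and moreover $\mathrm{res}^{s}_{a}:\mathcal F(s)\to\mathcal F(a)$ is an isomorphism. It is a beat element if it is an upbeat or a downbeat. *)

(* Defs.v *)
From HB Require Import structures.
From mathcomp Require Import all_boot all_order all_algebra.
From mathcomp Require Import boolp.

Set Implicit Arguments.
Unset Strict Implicit.
Unset Printing Implicit Defensive.

Import Order.TTheory GRing.Theory.
Local Open Scope ring_scope.

#[local] Obligation Tactic := idtac.

Declare Scope cat_scope.
Delimit Scope cat_scope with cat.
Local Open Scope cat_scope.

(* zmodType carries decidable equality and choice, which any abelian group   *)
(* has classically.                                                          *)
Record preadditive := Preadditive {
  obj :> Type;
  hom : obj -> obj -> zmodType;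
  idm : forall A, hom A A;
  comp : forall A B C, hom B C -> hom A B -> hom A C;
  compA : forall A B C D (h : hom C D) (g : hom B C) (f : hom A B),
    comp h (comp g f) = comp (comp h g) f;
  comp1m : forall A B (f : hom A B), comp (idm B) f = f;
  compm1 : forall A B (f : hom A B), comp f (idm A) = f;
  compDl : forall A B C (g g' : hom B C) (f : hom A B),
    comp (g + g') f = comp g f + comp g' f;
  compDr : forall A B C (g : hom B C) (f f' : hom A B),
    comp g (f + f') = comp g f + comp g f' }.

Notation "A ~> B" := (hom A B) (at level 90, no associativity) : cat_scope.
Notation "g ∘ f" := (comp g f) (at level 40, left associativity) : cat_scope.

Section Preadditive.
Context {C : preadditive}.
Implicit Types A B X Y Z : C.

Lemma comp0m A B X (f : A ~> B) : (0 : B ~> X) ∘ f = 0.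
Proof. by apply: (@addrI _ (0 ∘ f)); rewrite -compDl !addr0. Qed.

Lemma compm0 A B X (g : B ~> X) : g ∘ (0 : A ~> B) = 0.
Proof. by apply: (@addrI _ (g ∘ 0)); rewrite -compDr !addr0. Qed.

Lemma compNm A B X (g : B ~> X) (f : A ~> B) : (- g) ∘ f = - (g ∘ f).
Proof. by apply/eqP; rewrite -addr_eq0 -compDl addNr comp0m. Qed.

Lemma compmN A B X (g : B ~> X) (f : A ~> B) : g ∘ (- f) = - (g ∘ f).
Proof. by apply/eqP; rewrite -addr_eq0 -compDr addNr compm0. Qed.

Lemma compBl A B X (g g' : B ~> X) (f : A ~> B) :
  (g - g') ∘ f = g ∘ f - g' ∘ f.
Proof. by rewrite compDl compNm. Qed.

Lemma compBr A B X (g : B ~> X) (f f' : A ~> B) :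
  g ∘ (f - f') = g ∘ f - g ∘ f'.
Proof. by rewrite compDr compmN. Qed.

Definition mono A B (f : A ~> B) :=
  forall X (g h : X ~> A), f ∘ g = f ∘ h -> g = h.

Definition epi A B (f : A ~> B) :=
  forall X (g h : B ~> X), g ∘ f = h ∘ f -> g = h.

Definition is_iso A B (f : A ~> B) :=
  exists g : B ~> A, g ∘ f = idm A /\ f ∘ g = idm B.

Definition is_zero Z :=
  forall X, (forall f : X ~> Z, f = 0) /\ (forall f : Z ~> X, f = 0).

Definition is_biproduct A B P (i1 : A ~> P) (i2 : B ~> P)
    (p1 : P ~> A) (p2 : P ~> B) :=
  [/\ p1 ∘ i1 = idm A, p2 ∘ i2 = idm B, p1 ∘ i2 = 0, p2 ∘ i1 = 0
    & i1 ∘ p1 + i2 ∘ p2 = idm P].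

Definition is_kernel A B K (f : A ~> B) (k : K ~> A) :=
  f ∘ k = 0 /\ forall X (x : X ~> A), f ∘ x = 0 -> exists! y, k ∘ y = x.

Definition is_cokernel A B Q (f : A ~> B) (q : B ~> Q) :=
  q ∘ f = 0 /\ forall X (x : B ~> X), x ∘ f = 0 -> exists! y, y ∘ q = x.

Definition injective_obj I :=
  forall A B (m : A ~> B) (f : A ~> I), mono m -> exists g : B ~> I, g ∘ m = f.

End Preadditive.

Definition enough_injectives (C : preadditive) :=
  forall A : C, exists I (m : A ~> I), mono m /\ injective_obj I.

Record abelian := Abelian {
  abcat :> preadditive;
  ab_zero : exists Z : abcat, is_zero Z;
  ab_biproduct : forall A B : abcat,
    exists P (i1 : A ~> P) (i2 : B ~> P) p1 p2, is_biproduct i1 i2 p1 p2;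
  ab_kernel : forall (A B : abcat) (f : A ~> B),
    exists K (k : K ~> A), is_kernel f k;
  ab_cokernel : forall (A B : abcat) (f : A ~> B),
    exists Q (q : B ~> Q), is_cokernel f q;
  ab_mono_normal : forall (A B : abcat) (f : A ~> B), mono f ->
    exists Q (q : B ~> Q), is_kernel q f;
  ab_epi_normal : forall (A B : abcat) (f : A ~> B), epi f ->
    exists K (k : K ~> A), is_cokernel k f }.

Section PreadditiveTheory.
Context {C : preadditive}.
Implicit Types A B X Y Z : C.

Lemma is_kernel_mono A B K (f : A ~> B) (k : K ~> A) : is_kernel f k -> mono k.
Proof.
move=> [fk0 kP] X g h gh; have [|y [_ yU]] := kP X (k ∘ g).
  by rewrite compA fk0 comp0m.
by rewrite -(yU g) // -(yU h).
Qed.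

Lemma is_cokernel_epi A B Q (f : A ~> B) (q : B ~> Q) :
  is_cokernel f q -> epi q.
Proof.
move=> [qf0 qP] X g h gh; have [|y [_ yU]] := qP X (g ∘ q).
  by rewrite -compA qf0 compm0.
by rewrite -(yU g) // -(yU h).
Qed.

Lemma is_kernelI A B K (f : A ~> B) (k : K ~> A) : mono k -> f ∘ k = 0 ->
  (forall X (x : X ~> A), f ∘ x = 0 -> exists y, k ∘ y = x) -> is_kernel f k.
Proof.
move=> km fk0 kP; split=> // X x /kP[y yx]; exists y; split=> // z zx.
by apply: km; rewrite yx zx.
Qed.

Lemma is_cokernelI A B Q (f : A ~> B) (q : B ~> Q) : epi q -> q ∘ f = 0 ->
  (forall X (x : B ~> X), x ∘ f = 0 -> exists y, y ∘ q = x) ->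
  is_cokernel f q.
Proof.
move=> km fk0 kP; split=> // X x /kP[y yx]; exists y; split=> // z zx.
by apply: km; rewrite yx zx.
Qed.

Lemma mono_comp A B X (g : B ~> X) (f : A ~> B) :
  mono g -> mono f -> mono (g ∘ f).
Proof. by move=> gm fm Y h h'; rewrite -!compA => /gm/fm. Qed.

Lemma mono0 A B (f : A ~> B) :
  (forall X (x : X ~> A), f ∘ x = 0 -> x = 0) -> mono f.
Proof.
move=> f0 X g h fgh; apply/eqP; rewrite -subr_eq0; apply/eqP/f0.
by rewrite compBr fgh subrr.
Qed.

Lemma epi0 A B (f : A ~> B) :
  (forall X (x : B ~> X), x ∘ f = 0 -> x = 0) -> epi f.
Proof.
move=> f0 X g h fgh; apply/eqP; rewrite -subr_eq0; apply/eqP/f0.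
by rewrite compBl fgh subrr.
Qed.

Lemma is_kernel_mono_comp A B D K (f : A ~> B) (m : B ~> D) (k : K ~> A) :
  mono m -> is_kernel f k -> is_kernel (m ∘ f) k.
Proof.
move=> mm [fk0 kP]; split; first by rewrite -compA fk0 compm0.
by move=> X x mfx; apply: kP; apply: mm; rewrite compA mfx compm0.
Qed.

Lemma is_cokernel_comp_epi A B D Q (f : A ~> B) (e : D ~> A) (q : B ~> Q) :
  epi e -> is_cokernel f q -> is_cokernel (f ∘ e) q.
Proof.
move=> ee [qf0 qP]; split; first by rewrite compA qf0 comp0m.
by move=> X x mfx; apply: qP; apply: ee; rewrite -compA mfx comp0m.
Qed.

End PreadditiveTheory.

Section Abelian.
Context {C : abelian}.
Implicit Types A B X Y Z : C.

Lemma ker_ex A B (f : A ~> B) :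
  exists p : {K : C & K ~> A}, is_kernel f (projT2 p).
Proof. by have [K [k kP]] := ab_kernel f; exists (existT _ K k). Qed.

Lemma coker_ex A B (f : A ~> B) :
  exists p : {Q : C & B ~> Q}, is_cokernel f (projT2 p).
Proof. by have [K [k kP]] := ab_cokernel f; exists (existT _ K k). Qed.

Definition zero_obj : C := projT1 (cid (ab_zero C)).
Definition ker A B (f : A ~> B) : C := projT1 (projT1 (cid (ker_ex f))).
Definition kerm A B (f : A ~> B) : ker f ~> A := projT2 (projT1 (cid (ker_ex f))).
Definition coker A B (f : A ~> B) : C := projT1 (projT1 (cid (coker_ex f))).
Definition cokerm A B (f : A ~> B) : B ~> coker f :=
  projT2 (projT1 (cid (coker_ex f))).

Lemma kermP A B (f : A ~> B) : is_kernel f (kerm f).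
Proof. exact: (projT2 (cid (ker_ex f))). Qed.

Lemma cokermP A B (f : A ~> B) : is_cokernel f (cokerm f).
Proof. exact: (projT2 (cid (coker_ex f))). Qed.

Lemma zero_objP : is_zero zero_obj.
Proof. exact: (projT2 (cid (ab_zero C))). Qed.

Lemma kerm_mono A B (f : A ~> B) : mono (kerm f).
Proof. exact: is_kernel_mono (kermP f). Qed.

Lemma cokerm_epi A B (f : A ~> B) : epi (cokerm f).
Proof. exact: is_cokernel_epi (cokermP f). Qed.

Lemma ker0 A B (f : A ~> B) : f ∘ kerm f = 0.
Proof. by have [] := kermP f. Qed.

Lemma coker0 A B (f : A ~> B) : cokerm f ∘ f = 0.
Proof. by have [] := cokermP f. Qed.

Lemma ker_lift_ex A B (f : A ~> B) X (x : X ~> A) :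
  f ∘ x = 0 -> exists y, kerm f ∘ y = x.
Proof. by move/(proj2 (kermP f)) => [y [yP _]]; exists y. Qed.

Lemma coker_lift_ex A B (f : A ~> B) X (x : B ~> X) :
  x ∘ f = 0 -> exists y, y ∘ cokerm f = x.
Proof. by move/(proj2 (cokermP f)) => [y [yP _]]; exists y. Qed.

Definition ker_lift A B (f : A ~> B) X (x : X ~> A) (fx0 : f ∘ x = 0) :
  X ~> ker f := projT1 (cid (ker_lift_ex fx0)).

Definition coker_lift A B (f : A ~> B) X (x : B ~> X) (xf0 : x ∘ f = 0) :
  coker f ~> X := projT1 (cid (coker_lift_ex xf0)).

Lemma ker_liftE A B (f : A ~> B) X (x : X ~> A) (fx0 : f ∘ x = 0) :
  kerm f ∘ ker_lift fx0 = x.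
Proof. exact: (projT2 (cid (ker_lift_ex fx0))). Qed.

Lemma coker_liftE A B (f : A ~> B) X (x : B ~> X) (xf0 : x ∘ f = 0) :
  coker_lift xf0 ∘ cokerm f = x.
Proof. exact: (projT2 (cid (coker_lift_ex xf0))). Qed.

(* im f = ker (coker f) *)
Definition imm A B (f : A ~> B) : ker (cokerm f) ~> B := kerm (cokerm f).

Definition exact A B D (f : A ~> B) (g : B ~> D) := is_kernel g (imm f).

Lemma is_kernel_cokerm A B (f : A ~> B) : mono f -> is_kernel (cokerm f) f.
Proof.
move=> fm; have [Q [q [qf0 fP]]] := ab_mono_normal fm.
apply: is_kernelI => //; first exact: coker0.
move=> X x x0; have [y [yx _]] : exists! y, f ∘ y = x; last by exists y.
by apply: fP; rewrite -(coker_liftE qf0) -compA x0 compm0.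
Qed.

Lemma is_cokernel_kerm A B (f : A ~> B) : epi f -> is_cokernel (kerm f) f.
Proof.
move=> fm; have [Q [q [qf0 fP]]] := ab_epi_normal fm.
apply: is_cokernelI => //; first exact: ker0.
move=> X x x0; have [y [yx _]] : exists! y, y ∘ f = x; last by exists y.
by apply: fP; rewrite -(ker_liftE qf0) compA x0 comp0m.
Qed.

Lemma is_kernel_iso A B K (f : A ~> B) (k : K ~> A) :
  is_kernel f k -> exists2 i : K ~> ker f, kerm f ∘ i = k & is_iso i.
Proof.
move=> kP; have [fk0 kU] := kP; exists (ker_lift fk0); first exact: ker_liftE.
have [j [jE _]] := kU _ _ (ker0 f); exists j; split.
  by apply: (is_kernel_mono kP); rewrite compA jE ker_liftE compm1.
by apply: (@kerm_mono _ _ f); rewrite compA ker_liftE jE compm1.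
Qed.

Lemma is_cokernel_iso A B K (f : A ~> B) (k : B ~> K) :
  is_cokernel f k -> exists2 i : coker f ~> K, i ∘ cokerm f = k & is_iso i.
Proof.
move=> kP; have [fk0 kU] := kP; exists (coker_lift fk0); first exact: coker_liftE.
have [j [jE _]] := kU _ _ (coker0 f); exists j; split.
  by apply: (@cokerm_epi _ _ f); rewrite -compA coker_liftE jE comp1m.
by apply: (is_cokernel_epi kP); rewrite -compA jE coker_liftE comp1m.
Qed.

Lemma is_kernel_compiso A B K K' (f : A ~> B) (k : K ~> A) (i : K' ~> K) :
  is_iso i -> is_kernel f k -> is_kernel f (k ∘ i).
Proof.
move=> [j [ji ij]] kP; have [fk0 kU] := kP; apply: is_kernelI.
- apply: mono_comp; first exact: is_kernel_mono kP.
  by move=> X g h /(congr1 (comp j)); rewrite !compA ji !comp1m.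
- by rewrite compA fk0 comp0m.
- move=> X x /kU[y [yx _]]; exists (j ∘ y).
  by rewrite -compA (compA i) ij comp1m.
Qed.

Lemma is_iso_inv A B (f : A ~> B) (fi : is_iso f) :
  exists2 g : B ~> A, is_iso g & g ∘ f = idm A /\ f ∘ g = idm B.
Proof. by case: fi => g [gf fg]; exists g => //; exists f. Qed.

Lemma exactP A B D (f : A ~> B) (g : B ~> D) Q (c : B ~> Q) K (k : K ~> B) :
  is_cokernel f c -> is_kernel c k -> exact f g <-> is_kernel g k.
Proof.
move=> cP kP.
have kP' : is_kernel (cokerm f) k.
  have [i iE [j [ji ij]]] := is_cokernel_iso cP.
  have -> : cokerm f = j ∘ c by rewrite -iE compA ji comp1m.
  apply: is_kernel_mono_comp kP => X x y.
  by move=> /(congr1 (comp i)); rewrite !compA ij !comp1m.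
have [i ik ii] := is_kernel_iso kP'.
have [j ji [ij1 ij2]] := is_iso_inv ii.
split; rewrite /exact /imm.
  by rewrite -ik; apply: is_kernel_compiso.
have -> : kerm (cokerm f) = k ∘ j by rewrite -ik -compA ij2 compm1.
exact: is_kernel_compiso.
Qed.

Lemma exact_fact A B D K (f : A ~> B) (g : B ~> D) (k : K ~> B) (e : A ~> K) :
  epi e -> is_kernel g k -> k ∘ e = f -> exact f g.
Proof.
move=> ee kP <-; have km := is_kernel_mono kP.
have cP := is_cokernel_comp_epi ee (cokermP k).
by apply/(exactP _ cP (is_kernel_cokerm km)).
Qed.

Lemma exact0 A B D (f : A ~> B) (g : B ~> D) : exact f g -> g ∘ f = 0.
Proof.
move=> [gi0 _]; rewrite -(ker_liftE (coker0 f)) compA.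
by rewrite /imm in gi0; rewrite gi0 comp0m.
Qed.

Lemma exact_coim_mono A B D (f : A ~> B) (g : B ~> D) (gf0 : g ∘ f = 0) :
  exact f g -> mono (coker_lift gf0).
Proof.
move=> fgP; set c := cokerm f; set v := coker_lift gf0.
apply: mono0 => X x vx0; pose q := cokerm x.
have qcE : epi (q ∘ c).
  by move=> Y h h'; rewrite !compA => /cokerm_epi/cokerm_epi.
have [Z [z [qcz zP]]] := ab_epi_normal qcE.
have gz0 : g ∘ z = 0.
  rewrite -(coker_liftE gf0) -/v -/c.
  by rewrite -(coker_liftE vx0) -/q -!compA [q ∘ _]compA qcz compm0.
have cz0 : c ∘ z = 0.
  have [_ /(_ _ _ gz0)[y [<- _]]] := fgP.
  by rewrite compA /imm ker0 comp0m.
have [t [tE _]] := zP _ _ cz0.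
have tq : t ∘ q = idm _ by apply: (@cokerm_epi _ _ f); rewrite -compA tE comp1m.
by rewrite -(comp1m x) -tq -compA coker0 compm0.
Qed.

Lemma exact_extend A B D I (f : A ~> B) (g : B ~> D) (h : B ~> I) :
  injective_obj I -> exact f g -> h ∘ f = 0 -> exists k : D ~> I, k ∘ g = h.
Proof.
move=> Iinj fgP hf0; have gf0 := exact0 fgP.
have [k kE] := Iinj _ _ _ (coker_lift hf0) (exact_coim_mono fgP).
by exists k; rewrite -(coker_liftE gf0) compA kE coker_liftE.
Qed.

End Abelian.

Record functor (C D : preadditive) := Functor {
  fobj :> C -> D;
  fmap : forall A B, (A ~> B) -> (fobj A ~> fobj B);
  fmap1 : forall A, fmap (idm A) = idm (fobj A);
  fmapM : forall A B X (g : B ~> X) (f : A ~> B),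
    fmap (g ∘ f) = fmap g ∘ fmap f;
  fmapD : forall A B (f g : A ~> B), fmap (f + g) = fmap f + fmap g }.

Lemma fmap0 C D (F : functor C D) A B : fmap F (0 : A ~> B) = 0.
Proof. by apply: (@addrI _ (fmap F 0)); rewrite -fmapD !addr0. Qed.

Lemma fmapN C D (F : functor C D) A B (f : A ~> B) : fmap F (- f) = - fmap F f.
Proof. by apply/eqP; rewrite -addr_eq0 -fmapD addNr fmap0. Qed.

Lemma fmapB C D (F : functor C D) A B (f g : A ~> B) :
  fmap F (f - g) = fmap F f - fmap F g.
Proof. by rewrite fmapD fmapN. Qed.

Program Definition functor_comp C D E (G : functor D E) (F : functor C D) :=
  @Functor C E (fun A => G (F A)) (fun A B f => fmap G (fmap F f)) _ _ _.
Next Obligation. by move=> C D E G F A /=; rewrite !fmap1. Qed.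
Next Obligation. by move=> C D E G F A B X g f /=; rewrite !fmapM. Qed.
Next Obligation. by move=> C D E G F A B f g /=; rewrite !fmapD. Qed.

Record nat_trans C D (F G : functor C D) := NatTrans {
  ntrans :> forall A, F A ~> G A;
  ntransP : forall A B (f : A ~> B), fmap G f ∘ ntrans A = ntrans B ∘ fmap F f }.

Definition exact_functor (C D : abelian) (F : functor C D) :=
  forall A B X (f : A ~> B) (g : B ~> X), exact f g ->
    exact (fmap F f) (fmap F g).

Definition short_exact (C : abelian) (A B X : C) (f : A ~> B) (g : B ~> X) :=
  [/\ mono f, exact f g & epi g].

Section Complexes.
Context {C : abelian}.

Record complex := Complex {
  cob :> nat -> C;
  cdiff : forall n, cob n ~> cob n.+1;
  cdiff2 : forall n, cdiff n.+1 ∘ cdiff n = 0 }.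

Record cmap (X Y : complex) := CMap {
  cmapf :> forall n, X n ~> Y n;
  cmapP : forall n, cdiff Y n ∘ cmapf n = cmapf n.+1 ∘ cdiff X n }.

Program Definition cmap_id (X : complex) : cmap X X :=
  @CMap X X (fun n => idm (X n)) _.
Next Obligation. by move=> X n /=; rewrite comp1m compm1. Qed.

Program Definition cmap_comp (X Y Z : complex) (g : cmap Y Z) (f : cmap X Y) :=
  @CMap X Z (fun n => g n ∘ f n) _.
Next Obligation. by move=> X Y Z g f n /=; rewrite compA cmapP -!compA cmapP. Qed.

Program Definition cmap_add (X Y : complex) (f g : cmap X Y) :=
  @CMap X Y (fun n => f n + g n) _.
Next Obligation. by move=> X Y f g n /=; rewrite compDl compDr !cmapP. Qed.

Definition cprev (X : complex) n : C := if n is m.+1 then X m else zero_obj.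

Definition cin (X : complex) n : cprev X n ~> X n :=
  match n with 0 => 0 | m.+1 => cdiff X m end.

Lemma cinP (X : complex) n : cdiff X n ∘ cin X n = 0.
Proof. by case: n => [|n] /=; rewrite ?compm0 ?cdiff2. Qed.

Definition cocycles (X : complex) n : C := ker (cdiff X n).
Definition boundary (X : complex) n : cprev X n ~> cocycles X n :=
  ker_lift (cinP X n).
Definition cohom (X : complex) n : C := coker (boundary X n).
Definition cohom_class (X : complex) n : cocycles X n ~> cohom X n :=
  cokerm (boundary X n).

Lemma cocycles_mapP (X Y : complex) (f : cmap X Y) n :
  cdiff Y n ∘ (f n ∘ kerm (cdiff X n)) = 0.
Proof. by rewrite compA cmapP -compA ker0 compm0. Qed.

Definition cocycles_map (X Y : complex) (f : cmap X Y) n :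
  cocycles X n ~> cocycles Y n := ker_lift (cocycles_mapP f n).

Lemma class_cin0 (X : complex) n W (y : W ~> cocycles X n)
    (w : W ~> cprev X n) : kerm (cdiff X n) ∘ y = cin X n ∘ w ->
  cohom_class X n ∘ y = 0.
Proof.
move=> yw; have -> : y = boundary X n ∘ w.
  by apply: (@kerm_mono _ _ _ (cdiff X n)); rewrite compA ker_liftE.
by rewrite compA coker0 comp0m.
Qed.

Lemma cohom_mapP (X Y : complex) (f : cmap X Y) n :
  cohom_class Y n ∘ cocycles_map f n ∘ boundary X n = 0.
Proof.
rewrite -compA.
have E : kerm (cdiff Y n) ∘ (cocycles_map f n ∘ boundary X n)
    = f n ∘ cin X n by rewrite compA ker_liftE -compA ker_liftE.
case: n E => [|n] E.
  by apply: (@class_cin0 _ _ _ _ 0); rewrite E /= compm0 comp0m.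
by apply: (@class_cin0 Y n.+1 (cprev X n.+1) _ (f n)); rewrite E /= cmapP.
Qed.

Definition cohom_map (X Y : complex) (f : cmap X Y) n : cohom X n ~> cohom Y n :=
  coker_lift (cohom_mapP f n).

Lemma cohom_class_epi (X : complex) n : epi (cohom_class X n).
Proof. exact: cokerm_epi. Qed.

Lemma cohom_mapE (X Y : complex) (f : cmap X Y) n :
  cohom_map f n ∘ cohom_class X n = cohom_class Y n ∘ cocycles_map f n.
Proof. exact: coker_liftE. Qed.

Lemma cohom_map_id (X : complex) n : cohom_map (cmap_id X) n = idm _.
Proof.
apply: (@cohom_class_epi X n); rewrite cohom_mapE comp1m.
suff -> : cocycles_map (cmap_id X) n = idm _ by rewrite compm1.
by apply: (@kerm_mono _ _ _ (cdiff X n)); rewrite ker_liftE comp1m compm1.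
Qed.

Lemma cohom_map_comp (X Y Z : complex) (g : cmap Y Z) (f : cmap X Y) n :
  cohom_map (cmap_comp g f) n = cohom_map g n ∘ cohom_map f n.
Proof.
apply: (@cohom_class_epi X n).
rewrite cohom_mapE -compA cohom_mapE compA cohom_mapE -compA; congr (_ ∘ _).
by apply: (@kerm_mono _ _ _ (cdiff Z n)); rewrite compA !ker_liftE -!compA ker_liftE.
Qed.

Lemma cohom_map_add (X Y : complex) (f g : cmap X Y) n :
  cohom_map (cmap_add f g) n = cohom_map f n + cohom_map g n.
Proof.
apply: (@cohom_class_epi X n).
rewrite compDl !cohom_mapE -compDr; congr (_ ∘ _).
by apply: (@kerm_mono _ _ _ (cdiff Y n)); rewrite compDr !ker_liftE compDl.
Qed.

Definition homotopic (X Y : complex) (f g : cmap X Y) :=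
  exists2 h : forall n, X n.+1 ~> Y n, f 0 - g 0 = h 0 ∘ cdiff X 0 &
    forall n, f n.+1 - g n.+1 = cdiff Y n ∘ h n + h n.+1 ∘ cdiff X n.+1.

Lemma cohom_map_homotopic (X Y : complex) (f g : cmap X Y) n :
  homotopic f g -> cohom_map f n = cohom_map g n.
Proof.
move=> [h h0 hS]; apply: (@cohom_class_epi X n); rewrite !cohom_mapE.
apply/eqP; rewrite -subr_eq0 -compBr; apply/eqP.
pose w : cocycles X n ~> cprev Y n :=
  match n return cocycles X n ~> cprev Y n with
  | 0 => 0 | m.+1 => h m ∘ kerm (cdiff X m.+1) end.
apply: (@class_cin0 _ _ _ _ w); rewrite compBr !ker_liftE -compBl {}/w.
case: n => [|n] /=; first by rewrite h0 -compA ker0 !compm0.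
by rewrite hS compDl -!compA ker0 compm0 addr0.
Qed.

End Complexes.
Arguments complex : clear implicits.

Section FunctorComplex.
Context (C D : abelian) (T : functor C D).

Program Definition fcomplex (X : complex C) : complex D :=
  @Complex D (fun n => T (X n)) (fun n => fmap T (cdiff X n)) _.
Next Obligation. by move=> X n /=; rewrite -fmapM cdiff2 fmap0. Qed.

Program Definition fcmap (X Y : complex C) (f : cmap X Y) :
    cmap (fcomplex X) (fcomplex Y) :=
  @CMap D (fcomplex X) (fcomplex Y) (fun n => fmap T (f n)) _.
Next Obligation. by move=> X Y f n /=; rewrite -!fmapM cmapP. Qed.

Lemma fcmap_homotopic (X Y : complex C) (f g : cmap X Y) :
  homotopic f g -> homotopic (fcmap f) (fcmap g).
Proof.
move=> [h h0 hS]; exists (fun n => fmap T (h n)) => [|n] /=.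
  by rewrite -fmapB h0 fmapM.
by rewrite -fmapB hS fmapD !fmapM.
Qed.

End FunctorComplex.

Program Definition ntrans_cmap (C D : abelian) (T T' : functor C D)
    (r : nat_trans T T') (X : complex C) : cmap (fcomplex T X) (fcomplex T' X) :=
  @CMap D (fcomplex T X) (fcomplex T' X) (fun n => r (X n)) _.
Next Obligation. by move=> C D T T' r X n /=; rewrite ntransP. Qed.

Section Resolutions.
Context {C : abelian}.

Definition is_resolution (A : C) (X : complex C) (e : A ~> X 0) :=
  [/\ mono e, exact e (cdiff X 0)
    & forall n, exact (cdiff X n) (cdiff X n.+1)].

Record inj_resolution (A : C) := InjResolution {
  irc :> complex C;
  iaug : A ~> irc 0;
  iresP : is_resolution iaug;
  iinj : forall n, injective_obj (irc n) }.

Lemma dep_rec (T : nat -> Type) (P : forall n, T n -> Prop)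
    (R : forall n, T n -> T n.+1 -> Prop) :
  (exists x, P 0 x) ->
  (forall n x, P n x -> exists2 y, P n.+1 y & R n x y) ->
  exists2 f : forall n, T n, P 0 (f 0) & forall n, R n (f n) (f n.+1).
Proof.
move=> /cid[x0 Px0] step.
pose F := fix F n : {x : T n | P n x} := match n with
  | 0 => exist _ x0 Px0
  | m.+1 => let y := cid2 (step m _ (proj2_sig (F m))) in
            exist _ (s2val y) (s2valP y) end.
exists (fun n => proj1_sig (F n)) => // n /=.
by case: (cid2 _).
Qed.

Lemma comparison (A B : C) (X Y : complex C) (eX : A ~> X 0) (eY : B ~> Y 0)
    (f : A ~> B) :
  is_resolution eX -> (forall n, injective_obj (Y n)) -> cdiff Y 0 ∘ eY = 0 ->
  exists phi : cmap X Y, phi 0 ∘ eX = eY ∘ f.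
Proof.
move=> [eXm eX0 Xex] Yinj eY0.
pose P n (p : X n ~> Y n) := match n return (X n ~> Y n) -> Prop with
  | 0 => fun p => p ∘ eX = eY ∘ f
  | m.+1 => fun p => cdiff Y m.+1 ∘ p ∘ cdiff X m = 0 end p.
pose R n (p : X n ~> Y n) (q : X n.+1 ~> Y n.+1) :=
  cdiff Y n ∘ p = q ∘ cdiff X n.
have [||phi phi0 phiS] := @dep_rec (fun n => X n ~> Y n) P R.
- by have [p pE] := Yinj 0 _ _ eX (eY ∘ f) eXm; exists p.
- move=> n p Pp; have [q qE] : exists q, q ∘ cdiff X n = cdiff Y n ∘ p.
    case: n p Pp => [|n] p /= Pp.
      apply: exact_extend eX0 _ => //.
      by rewrite -compA Pp compA eY0 comp0m.
    exact: exact_extend (Xex n) Pp.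
  by exists q => //=; rewrite -compA qE compA cdiff2 comp0m.
- by exists (CMap phiS).
Qed.

Lemma comparison_homotopic (A : C) (X Y : complex C) (eX : A ~> X 0)
    (phi psi : cmap X Y) :
  is_resolution eX -> (forall n, injective_obj (Y n)) ->
  phi 0 ∘ eX = psi 0 ∘ eX -> homotopic phi psi.
Proof.
move=> [eXm eX0 Xex] Yinj e0.
pose D n := phi n - psi n.
have DP n : cdiff Y n ∘ D n = D n.+1 ∘ cdiff X n.
  by rewrite /D compBr compBl !cmapP.
pose P n (h : X n.+1 ~> Y n) := match n return (X n.+1 ~> Y n) -> Prop with
  | 0 => fun h => D 0 = h ∘ cdiff X 0
  | m.+1 => fun h => cdiff Y m.+1 ∘ (D m.+1 - h ∘ cdiff X m.+1) = 0 end h.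
pose R n (h : X n.+1 ~> Y n) (k : X n.+2 ~> Y n.+1) :=
  D n.+1 = cdiff Y n ∘ h + k ∘ cdiff X n.+1.
have [||h h0 hS] := @dep_rec (fun n => X n.+1 ~> Y n) P R; last by exists h.
  have [|h hE] := exact_extend (h := D 0) (Yinj 0) eX0; last by exists h.
  by rewrite /D compBl e0 subrr.
move=> n h Ph; have Ph' : cdiff Y n ∘ (D n - h ∘ cdiff X n) = 0.
  by case: n h Ph => [|n] h //= ->; rewrite subrr compm0.
have [|k kE] := exact_extend (h := D n.+1 - cdiff Y n ∘ h) (Yinj n.+1) (Xex n).
  by rewrite compBl -DP -compA -compBr Ph'.
exists k; rewrite /= ?kE /R ?kE; last by rewrite addrC subrK.
by rewrite opprB addrC subrK compA cdiff2 comp0m.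
Qed.

Section EnoughInjectives.
Context (inj : enough_injectives C).

Lemma hull_ex (A : C) :
  exists p : {I : C & A ~> I}, mono (projT2 p) /\ injective_obj (projT1 p).
Proof. by have [I [m mP]] := inj A; exists (existT _ I m). Qed.

Definition hull (A : C) : C := projT1 (projT1 (cid (hull_ex A))).
Definition emb (A : C) : A ~> hull A := projT2 (projT1 (cid (hull_ex A))).

Lemma emb_mono A : mono (emb A).
Proof. by have [] := projT2 (cid (hull_ex A)). Qed.

Lemma hull_inj A : injective_obj (hull A).
Proof. by have [] := projT2 (cid (hull_ex A)). Qed.

Fixpoint cosyzygy (A : C) n : C :=
  if n is m.+1 then coker (emb (cosyzygy A m)) else A.

Definition ires_diff (A : C) n : hull (cosyzygy A n) ~> hull (cosyzygy A n.+1) :=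
  emb (cosyzygy A n.+1) ∘ cokerm (emb (cosyzygy A n)).

Lemma ires_diff_ker A n : is_kernel (ires_diff A n) (emb (cosyzygy A n)).
Proof.
apply: is_kernel_mono_comp; first exact: emb_mono.
exact: is_kernel_cokerm (@emb_mono _).
Qed.

Lemma ires_diff2 A n : ires_diff A n.+1 ∘ ires_diff A n = 0.
Proof. by have [E _] := ires_diff_ker A n.+1; rewrite compA E comp0m. Qed.

Definition ires_complex (A : C) : complex C := Complex (ires_diff2 A).

Lemma ires_complexP A : @is_resolution A (ires_complex A) (emb A).
Proof.
split=> [||n]; first exact: emb_mono.
  apply: (@exact_fact _ _ _ _ _ _ _ (emb A) (idm A)); last by rewrite compm1.
    by move=> X g h; rewrite !compm1.
  exact: (ires_diff_ker A 0).
apply: (exact_fact _ (ires_diff_ker A n.+1) erefl); exact: cokerm_epi.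
Qed.

Lemma inj_resolution_ex (A : C) : exists I : inj_resolution A, True.
Proof.
by exists (InjResolution (ires_complexP A) (fun n => @hull_inj (cosyzygy A n))).
Qed.

Definition ires (A : C) : inj_resolution A := projT1 (cid (inj_resolution_ex A)).

End EnoughInjectives.
End Resolutions.

Lemma iaug0 (C : abelian) (A : C) (I : inj_resolution A) :
  cdiff I 0 ∘ iaug I = 0.
Proof. by have [_ /exact0 E _] := iresP I. Qed.

Section ExactFunctor.
Context {C D : abelian}.

Lemma imm0 (E : abelian) (A B : E) : imm (0 : A ~> B) = 0.
Proof.
have [c cE] := coker_lift_ex (compm0 A (idm B)).
by rewrite -(comp1m (imm _)) -cE -compA ker0 compm0.
Qed.

Lemma exact_mono (E : abelian) (A B : E) (f : A ~> B) :
  mono f <-> exact (0 : zero_obj ~> A) f.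
Proof.
split=> [fm | [_ fP]].
  apply: is_kernelI; first exact: kerm_mono; first by rewrite imm0 compm0.
  move=> X x fx0; exists 0; apply: fm; rewrite compm0 fx0 ?compm0 //.
by apply: mono0 => X x /fP[y [<- _]]; rewrite imm0 comp0m.
Qed.

Lemma exact_epi (E : abelian) (A B : E) (f : A ~> B) :
  epi f <-> exact f (0 : B ~> zero_obj).
Proof.
split=> [fe | [_ fP]].
  apply: (exact_fact fe _ (comp1m f)); split; first by rewrite comp0m.
  by move=> X x _; exists x; split=> [|y]; rewrite comp1m.
apply: epi0 => X x xf0; have [y <-] := coker_lift_ex xf0.
have [z [zE _]] := fP _ (idm B) (comp0m _ _).
suff -> : cokerm f = 0 by rewrite compm0.
by rewrite -(compm1 (cokerm f)) -zE compA ker0 comp0m.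
Qed.

Context (F : functor C D) (Fex : exact_functor F).

Lemma exact_functor_mono (A B : C) (f : A ~> B) : mono f -> mono (fmap F f).
Proof.
move=> /exact_mono/Fex; rewrite fmap0 => H.
apply: mono0 => X x fx0; have [_ /(_ _ _ fx0)[y [<- _]]] := H.
by rewrite imm0 comp0m.
Qed.

Lemma exact_functor_epi (A B : C) (f : A ~> B) : epi f -> epi (fmap F f).
Proof.
move=> /exact_epi/Fex; rewrite fmap0 => -[_ H].
apply: epi0 => X x xf0; have [y <-] := coker_lift_ex xf0.
have [z [zE _]] := H _ (idm _) (comp0m _ _).
suff -> : cokerm (fmap F f) = 0 by rewrite compm0.
by rewrite -(compm1 (cokerm _)) -zE compA ker0 comp0m.
Qed.

Lemma exact_functor_resolution (A : C) (X : complex C) (e : A ~> X 0) :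
  is_resolution e -> @is_resolution _ (F A) (fcomplex F X) (fmap F e).
Proof.
move=> [em e0 Xex]; split=> [||n] /=; [exact: exact_functor_mono| |]; exact: Fex.
Qed.

End ExactFunctor.

Lemma cmap_eq (C : abelian) (X Y : complex C) (f g : cmap X Y) :
  (forall n, f n = g n) -> f = g.
Proof.
case: f g => [f fP] [g gP] /= fg.
have E : f = g by apply: functional_extensionality_dep.
by rewrite E in fP *; congr CMap; apply: Prop_irrelevance.
Qed.

Section Derived.
Context {C D : abelian} (inj : enough_injectives C) (T : functor C D).

Lemma ires_map_ex (A B : C) (f : A ~> B) :
  exists phi : cmap (ires inj A) (ires inj B),
    phi 0 ∘ iaug (ires inj A) = iaug (ires inj B) ∘ f.
Proof. by apply: comparison; [exact: iresP|exact: iinj|exact: iaug0]. Qed.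

Definition ires_map (A B : C) (f : A ~> B) : cmap (ires inj A) (ires inj B) :=
  projT1 (cid (ires_map_ex f)).

Lemma ires_mapE (A B : C) (f : A ~> B) :
  ires_map f 0 ∘ iaug (ires inj A) = iaug (ires inj B) ∘ f.
Proof. exact: (projT2 (cid (ires_map_ex f))). Qed.

Definition derived_obj n (A : C) : D := cohom (fcomplex T (ires inj A)) n.

Definition derived_hom n (A B : C) (f : A ~> B) :
  derived_obj n A ~> derived_obj n B := cohom_map (fcmap T (ires_map f)) n.

Lemma derived_hom_uniq n (A B : C) (phi psi : cmap (ires inj A) (ires inj B)) :
  phi 0 ∘ iaug (ires inj A) = psi 0 ∘ iaug (ires inj A) ->
  cohom_map (fcmap T phi) n = cohom_map (fcmap T psi) n.
Proof.
move=> E; apply/cohom_map_homotopic/fcmap_homotopic.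
by apply: comparison_homotopic E; [exact: iresP|exact: iinj].
Qed.

Lemma derived1 n A : derived_hom n (idm A) = idm (derived_obj n A).
Proof.
rewrite -cohom_map_id /derived_hom.
have -> : cmap_id (fcomplex T (ires inj A)) = fcmap T (cmap_id (ires inj A)).
  by apply: cmap_eq => k /=; rewrite fmap1.
by apply: derived_hom_uniq; rewrite ires_mapE compm1 comp1m.
Qed.

Lemma derivedM n A B X (g : B ~> X) (f : A ~> B) :
  derived_hom n (g ∘ f) = derived_hom n g ∘ derived_hom n f.
Proof.
rewrite -cohom_map_comp /derived_hom.
have -> : cmap_comp (fcmap T (ires_map g)) (fcmap T (ires_map f)) =
    fcmap T (cmap_comp (ires_map g) (ires_map f)).
  by apply: cmap_eq => k /=; rewrite fmapM.
by apply: derived_hom_uniq; rewrite /= -compA !ires_mapE !compA ires_mapE.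
Qed.

Lemma derivedD n A B (f g : A ~> B) :
  derived_hom n (f + g) = derived_hom n f + derived_hom n g.
Proof.
rewrite -cohom_map_add /derived_hom.
have -> : cmap_add (fcmap T (ires_map f)) (fcmap T (ires_map g)) =
    fcmap T (cmap_add (ires_map f) (ires_map g)).
  by apply: cmap_eq => k /=; rewrite fmapD.
by apply: derived_hom_uniq; rewrite /= compDl !ires_mapE compDr.
Qed.

Definition derived n : functor C D :=
  Functor (derived1 n) (@derivedM n) (@derivedD n).

(* The canonical comparison T A -> R^0 T A; T need not be left exact here. *)
Lemma derived_augP A :
  cdiff (fcomplex T (ires inj A)) 0 ∘ fmap T (iaug (ires inj A)) = 0.
Proof. by rewrite /= -fmapM (iaug0 (ires inj A)) fmap0. Qed.

Definition derived_aug A : T A ~> derived 0 A :=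
  cohom_class (fcomplex T (ires inj A)) 0 ∘ ker_lift (derived_augP A).

End Derived.

(* The maps R^n T -> R^n T' o E induced, for E exact, by a natural           *)
(* transformation r : T -> T' o E: as E (ires A) is a resolution of E A, the *)
(* identity of E A lifts to E (ires A) -> ires (E A).                        *)
Section DerivedMap.
Context {C C' D : abelian}.
Context (inj : enough_injectives C) (inj' : enough_injectives C').
Context (T : functor C D) (T' : functor C' D) (E : functor C C').
Context (Eex : exact_functor E) (r : nat_trans T (functor_comp T' E)).

Lemma base_change_ex (A : C) :
  exists phi : cmap (fcomplex E (ires inj A)) (ires inj' (E A)),
    phi 0 ∘ fmap E (iaug (ires inj A)) = iaug (ires inj' (E A)) ∘ idm (E A).
Proof.
apply: comparison; [|exact: iinj|exact: iaug0].
exact: exact_functor_resolution (iresP _).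
Qed.

Definition base_change (A : C) :
    cmap (fcomplex E (ires inj A)) (ires inj' (E A)) :=
  projT1 (cid (base_change_ex A)).

Lemma base_changeE (A : C) :
  base_change A 0 ∘ fmap E (iaug (ires inj A)) = iaug (ires inj' (E A)).
Proof. by rewrite -[RHS]compm1; exact: (projT2 (cid (base_change_ex A))). Qed.

Program Definition derived_cmap (A : C) :
    cmap (fcomplex T (ires inj A)) (fcomplex T' (ires inj' (E A))) :=
  @CMap _ (fcomplex T (ires inj A)) (fcomplex T' (ires inj' (E A)))
    (fun n => fmap T' (base_change A n) ∘ r (ires inj A n)) _.
Next Obligation.
move=> A n /=; rewrite -[RHS]compA -(ntransP r) /= !compA -!fmapM.
by rewrite (cmapP (base_change A)).
Qed.

Definition derived_map_fun n (A : C) :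
    derived inj T n A ~> functor_comp (derived inj' T' n) E A :=
  cohom_map (derived_cmap A) n.

Lemma derived_map_nat n A B (f : A ~> B) :
  fmap (functor_comp (derived inj' T' n) E) f ∘ derived_map_fun n A =
  derived_map_fun n B ∘ fmap (derived inj T n) f.
Proof.
rewrite /= /derived_hom /derived_map_fun -!cohom_map_comp.
apply: cohom_map_homotopic.
have [||h h0 hS] := @comparison_homotopic _ _ _ (ires inj' (E B)) _
  (cmap_comp (ires_map inj' (fmap E f)) (base_change A))
  (cmap_comp (base_change B) (fcmap E (ires_map inj f)))
  (exact_functor_resolution Eex (iresP (ires inj A))).
- exact: iinj.
- rewrite /= -!compA base_changeE ires_mapE -!fmapM ires_mapE fmapM !compA.
  by rewrite base_changeE.
have rE n' : fmap T' (base_change B n') ∘ r (ires inj B n')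
      ∘ fmap T (ires_map inj f n') =
    fmap T' (base_change B n' ∘ fmap E (ires_map inj f n')) ∘ r (ires inj A n').
  by rewrite -compA -(ntransP r) /= fmapM !compA.
exists (fun k => fmap T' (h k) ∘ r (ires inj A k.+1)) => [|k] /=.
  rewrite rE !compA -fmapM -compBl -fmapB /= in h0 *.
  by rewrite h0 fmapM -!compA -(ntransP r).
rewrite rE !compA -!fmapM -compBl -fmapB.
by move: (hS k) => /= ->; rewrite fmapD compDl !fmapM -!compA -(ntransP r).
Qed.

Definition derived_map n :
    nat_trans (derived inj T n) (functor_comp (derived inj' T' n) E) :=
  NatTrans (@derived_map_nat n).

Lemma derived_map_aug (A : C) :
  derived_map 0 A ∘ derived_aug inj T A = derived_aug inj' T' (E A) ∘ r A.
Proof.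
rewrite /= /derived_map_fun /derived_aug compA cohom_mapE -!compA; congr (_ ∘ _).
apply: (@kerm_mono _ _ _ (cdiff (fcomplex T' (ires inj' (E A))) 0)).
rewrite !compA !ker_liftE -compA ker_liftE /= -compA -(ntransP r) /= compA -fmapM.
by rewrite base_changeE.
Qed.

End DerivedMap.

Section Shift.
Context {C : abelian}.

(* X[1] without the customary sign on the differential *)
Definition shift (X : complex C) : complex C :=
  @Complex C (fun n => X n.+1) (fun n => cdiff X n.+1) (fun n => cdiff2 X n.+1).

Context (X Y : complex C) (f : cmap X (shift Y)).

Lemma cocycles_map1P n : cdiff Y n.+1 ∘ (f n ∘ kerm (cdiff X n)) = 0.
Proof. by have := cocycles_mapP f n. Qed.

Definition cocycles_map1 n : cocycles X n ~> cocycles Y n.+1 :=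
  ker_lift (cocycles_map1P n).

Lemma cohom_map1P n : cohom_class Y n.+1 ∘ cocycles_map1 n ∘ boundary X n = 0.
Proof.
rewrite -compA.
have E : kerm (cdiff Y n.+1) ∘ (cocycles_map1 n ∘ boundary X n)
    = f n ∘ cin X n by rewrite compA ker_liftE -compA ker_liftE.
case: n E => [|n] E.
  by apply: (@class_cin0 _ _ _ _ _ 0); rewrite E /= !compm0.
by apply: (@class_cin0 _ Y n.+2 (cprev X n.+1) _ (f n)); rewrite E -(cmapP f).
Qed.

Definition cohom_map1 n : cohom X n ~> cohom Y n.+1 := coker_lift (cohom_map1P n).

Lemma cohom_map1E n :
  cohom_map1 n ∘ cohom_class X n = cohom_class Y n.+1 ∘ cocycles_map1 n.
Proof. exact: coker_liftE. Qed.

End Shift.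

Program Definition fcmap_shift (C D : abelian) (T : functor C D)
    (X Y : complex C) (f : cmap X (shift Y)) :
    cmap (fcomplex T X) (shift (fcomplex T Y)) :=
  @CMap D (fcomplex T X) (shift (fcomplex T Y)) (fun n => fmap T (f n)) _.
Next Obligation. by move=> C D T X Y f n /=; rewrite -!fmapM -(cmapP f). Qed.

(* For 0 -> A -> B -> X -> 0, extend the augmentation of A to b : B -> I^0.  *)
(* Then d b factors through a cocycle X -> I^1, which lifts to a chain map   *)
(* ires X -> (ires A)[1]; up to sign this is the map d s - s d given by a    *)
(* degreewise section s of a short exact sequence of resolutions, so on      *)
(* cohomology it is the usual connecting morphism up to a sign depending     *)
(* only on the degree.                                                       *)
Section Connecting.
Context {C D : abelian} (inj : enough_injectives C) (T : functor C D).

Lemma connecting_ex (A B X : C) (f : A ~> B) (g : B ~> X) : short_exact f g ->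
  exists phi : cmap (ires inj X) (shift (ires inj A)),
  exists2 b : B ~> ires inj A 0, b ∘ f = iaug (ires inj A) &
    phi 0 ∘ iaug (ires inj X) ∘ g = cdiff (ires inj A) 0 ∘ b.
Proof.
move=> [fm fg ge]; set I := ires inj A.
have [b bE] := @iinj _ _ I 0 _ _ f (iaug I) fm.
have [c cE] : exists c, c ∘ g = cdiff I 0 ∘ b.
  by apply: exact_extend fg _; [exact: iinj | rewrite -compA bE iaug0].
have dc : cdiff (shift I) 0 ∘ c = 0.
  by apply: ge; rewrite -compA cE compA /= cdiff2 !comp0m.
have [phi phiE] := @comparison _ _ _ _ (shift I) _ _ (idm X) (iresP (ires inj X))
  (fun n => @iinj _ _ I n.+1) dc.
by exists phi, b => //; rewrite phiE compm1 cE.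
Qed.

Definition connecting_cmap (A B X : C) (f : A ~> B) (g : B ~> X)
    (fg : short_exact f g) : cmap (ires inj X) (shift (ires inj A)) :=
  projT1 (cid (connecting_ex fg)).

Lemma connecting_cmapP (A B X : C) (f : A ~> B) (g : B ~> X)
    (fg : short_exact f g) :
  exists2 b : B ~> ires inj A 0, b ∘ f = iaug (ires inj A) &
    connecting_cmap fg 0 ∘ iaug (ires inj X) ∘ g = cdiff (ires inj A) 0 ∘ b.
Proof. exact: (projT2 (cid (connecting_ex fg))). Qed.

Definition connecting n (A B X : C) (f : A ~> B) (g : B ~> X)
    (fg : short_exact f g) : derived inj T n X ~> derived inj T n.+1 A :=
  cohom_map1 (fcmap_shift T (connecting_cmap fg)) n.

End Connecting.

Lemma exact_functor_short (C D : abelian) (F : functor C D)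
    (Fex : exact_functor F) (A B X : C) (f : A ~> B) (g : B ~> X) :
  short_exact f g -> short_exact (fmap F f) (fmap F g).
Proof.
move=> [fm fg ge]; split; [exact: exact_functor_mono|exact: Fex|].
exact: exact_functor_epi.
Qed.

Section DerivedMapDelta.
Context {C C' D : abelian}.
Context (inj : enough_injectives C) (inj' : enough_injectives C').
Context (T : functor C D) (T' : functor C' D) (E : functor C C').
Context (Eex : exact_functor E) (r : nat_trans T (functor_comp T' E)).

Lemma connecting_base_change (A B X : C) (f : A ~> B) (g : B ~> X)
    (fg : short_exact f g) :
  let Q := ires inj' (E A) in
  let phi := connecting_cmap inj fg in
  let phi' := connecting_cmap inj' (exact_functor_short Eex fg) in
  let a := base_change inj inj' Eex A in
  let b := base_change inj inj' Eex X in
  exists k : E (ires inj X 0) ~> Q 0,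
  exists2 h : forall n, E (ires inj X n.+1) ~> Q n.+1,
    a 1 ∘ fmap E (phi 0) - phi' 0 ∘ b 0 =
      cdiff Q 0 ∘ k + h 0 ∘ fmap E (cdiff (ires inj X) 0) &
    forall n, a n.+2 ∘ fmap E (phi n.+1) - phi' n.+1 ∘ b n.+1 =
      cdiff Q n.+1 ∘ h n + h n.+1 ∘ fmap E (cdiff (ires inj X) n.+1).
Proof.
move=> Q phi phi' a b; pose K := ires inj X.
have [u uf uE] := connecting_cmapP inj fg.
have [u' uf' uE'] := connecting_cmapP inj' (exact_functor_short Eex fg).
have [fm fgex ge] := exact_functor_short Eex fg.
pose del n := a n.+1 ∘ fmap E (phi n) - phi' n ∘ b n.
have delP n : cdiff Q n.+1 ∘ del n = del n.+1 ∘ fmap E (cdiff K n).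
  rewrite /del compBr compBl !compA (cmapP a) (cmapP phi') -!compA (cmapP b).
  by rewrite -!fmapM -(cmapP phi).
have [c cE] : exists c, c ∘ fmap E g = a 0 ∘ fmap E u - u'.
  apply: exact_extend fgex _; first exact: iinj.
  by rewrite compBl -compA -fmapM uf uf' base_changeE subrr.
have Kres := exact_functor_resolution Eex (iresP K).
have [k kE] : exists k, k ∘ fmap E (iaug K) = c.
  by have [em _ _] := Kres; exact: (@iinj _ _ Q 0).
have bE : b 0 ∘ fmap E (iaug K) = iaug (ires inj' (E X)) := base_changeE _ _ _ _.
have del0 : del 0 ∘ fmap E (iaug K) = cdiff Q 0 ∘ k ∘ fmap E (iaug K).
  apply: ge; rewrite -(compA (cdiff Q 0)) kE -[RHS]compA cE compBr.
  rewrite /del compBl -(compA (phi' 0)) bE compBl uE' -!compA -!fmapM compA.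
  by rewrite uE fmapM !compA (cmapP a).
pose del' n : E (K n) ~> shift Q n :=
  match n return E (K n) ~> shift Q n with
  | 0 => del 0 - cdiff Q 0 ∘ k | m.+1 => del m.+1 end.
have del'P n : cdiff (shift Q) n ∘ del' n = del' n.+1 ∘ cdiff (fcomplex E K) n.
  case: n => [|n] /=; last exact: delP.
  by rewrite compBr compA cdiff2 comp0m subr0 delP.
pose Z n : E (K n) ~> shift Q n := 0.
have ZP n : cdiff (shift Q) n ∘ Z n = Z n.+1 ∘ cdiff (fcomplex E K) n.
  by rewrite /Z compm0 comp0m.
have [||h h0 hS] := @comparison_homotopic _ _ (fcomplex E K) (shift Q) _
    (@CMap _ (fcomplex E K) (shift Q) del' del'P) (@CMap _ (fcomplex E K) (shift Q) Z ZP) Kres.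
- by move=> n; exact: (@iinj _ _ Q).
- by rewrite /= compBl del0 subrr comp0m.
exists k, h => [|n].
  by move: h0; rewrite /= /Z subr0 => <-; rewrite [RHS]addrC subrK.
by have := hS n; rewrite /= /Z subr0.
Qed.

Lemma derived_map_connecting n (A B X : C) (f : A ~> B) (g : B ~> X)
    (fg : short_exact f g) :
  derived_map inj inj' Eex r n.+1 A ∘ connecting inj T n fg =
  connecting inj' T' n (exact_functor_short Eex fg) ∘
    derived_map inj inj' Eex r n X.
Proof.
apply: (@cohom_class_epi _ (fcomplex T (ires inj X)) n).
rewrite -!compA /= /derived_map_fun cohom_mapE /connecting cohom_map1E.
rewrite !compA cohom_mapE cohom_map1E -!compA.
apply/eqP; rewrite -subr_eq0 -compBr; apply/eqP.
have [k [h h0 hS]] := connecting_base_change fg.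
pose w : cocycles (fcomplex T (ires inj X)) n ~> T' (ires inj' (E A) n) :=
  match n return cocycles (fcomplex T (ires inj X)) n ~> T' (ires inj' (E A) n) with
  | 0 => fmap T' k ∘ r _ ∘ kerm _ | m.+1 => fmap T' (h m) ∘ r _ ∘ kerm _ end.
apply: (@class_cin0 _ (fcomplex T' (ires inj' (E A))) n.+1 _ _ w).
rewrite compBr !compA !ker_liftE -!compA !ker_liftE /=.
rewrite (compA (r _)) -(ntransP r) /= !compA -!fmapM -!compBl -fmapB.
have r0 m : r (ires inj X m.+1) ∘ fmap T (cdiff (ires inj X) m) ∘
    kerm (fmap T (cdiff (ires inj X) m)) = 0 by rewrite -compA ker0 compm0.
rewrite {}/w; case: n => [|n] /=.
  rewrite h0 fmapD !compDl !fmapM -!compA [X in _ + _ ∘ X]compA.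
  by rewrite (ntransP r (cdiff (ires inj X) 0)) r0 compm0 addr0.
rewrite hS fmapD !compDl !fmapM -!compA [X in _ + _ ∘ X]compA.
by rewrite (ntransP r (cdiff (ires inj X) n.+1)) r0 compm0 addr0.
Qed.

End DerivedMapDelta.

Definition left_exact (C D : preadditive) (T : functor C D) :=
  forall A B K (f : A ~> B) (k : K ~> A), is_kernel f k ->
    is_kernel (fmap T f) (fmap T k).

Lemma resolution_kernel (C : abelian) (A : C) (X : complex C) (e : A ~> X 0) :
  is_resolution e -> is_kernel (cdiff X 0) e.
Proof.
move=> [em e0 _]; have [i iE [j [ji ij]]] := is_kernel_iso (is_kernel_cokerm em).
by rewrite -iE; apply: is_kernel_compiso e0; exists j.
Qed.

Lemma derived_aug_iso (C D : abelian) (inj : enough_injectives C)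
    (T : functor C D) (A : C) : left_exact T -> is_iso (derived_aug inj T A).
Proof.
move=> Tlex; set X := fcomplex T (ires inj A).
have [i iE [j [ji ij]]] :=
  is_kernel_iso (Tlex _ _ _ _ _ (resolution_kernel (iresP (ires inj A)))).
have iE' : ker_lift (derived_augP inj T A) = i.
  by apply: (@kerm_mono _ _ _ (cdiff X 0)); rewrite ker_liftE iE.
have b0 : idm _ ∘ boundary X 0 = 0.
  by rewrite comp1m; apply: (@kerm_mono _ _ _ (cdiff X 0)); rewrite ker_liftE compm0.
have [t tE] := coker_lift_ex b0.
have tE' : cohom_class X 0 ∘ t = idm _.
  by apply: (@cohom_class_epi _ X 0); rewrite -compA tE compm1 comp1m.
exists (j ∘ t); rewrite /derived_aug iE'; split.
  by rewrite -compA (compA t) tE comp1m.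
by rewrite -compA (compA i) ij comp1m.
Qed.

(* Sheaves on the Alexandrov space X_S (opens = upper sets), identified with *)
(* functors S -> V; the stalk at s is the value on the minimal open {t >= s}. *)
Record sheaf d (S : finPOrderType d) (V : preadditive) := Sheaf {
  stalk :> S -> V;
  res : forall s t : S, (s <= t)%O -> stalk s ~> stalk t;
  res_id : forall s (le_ss : (s <= s)%O), res le_ss = idm (stalk s);
  res_comp : forall s t u (le_st : (s <= t)%O) (le_tu : (t <= u)%O)
    (le_su : (s <= u)%O), res le_tu ∘ res le_st = res le_su }.

Record sheaf_hom d (S : finPOrderType d) (V : preadditive) (F G : sheaf S V) :=
  SheafHom {
    shom :> forall s, F s ~> G s;
    shomP : forall s t (le_st : (s <= t)%O),
      res G le_st ∘ shom s = shom t ∘ res F le_st }.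

Section SheafHom.
Context d (S : finPOrderType d) (V : preadditive).
Implicit Types F G H : sheaf S V.

Lemma shom_eq F G (f g : sheaf_hom F G) : (forall s, f s = g s) -> f = g.
Proof.
case: f g => [f fP] [g gP] /= fg.
have E : f = g by apply: functional_extensionality_dep.
by rewrite E in fP *; congr SheafHom; apply: Prop_irrelevance.
Qed.

HB.instance Definition _ F G := gen_eqMixin (sheaf_hom F G).
HB.instance Definition _ F G := gen_choiceMixin (sheaf_hom F G).

Program Definition shom_zero F G := @SheafHom d S V F G (fun s => 0) _.
Next Obligation. by move=> F G s t h /=; rewrite compm0 comp0m. Qed.

Program Definition shom_opp F G (f : sheaf_hom F G) :=
  @SheafHom d S V F G (fun s => - f s) _.
Next Obligation. by move=> F G f s t h /=; rewrite compmN compNm shomP. Qed.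

Program Definition shom_add F G (f g : sheaf_hom F G) :=
  @SheafHom d S V F G (fun s => f s + g s) _.
Next Obligation. by move=> F G f g s t h /=; rewrite compDl compDr !shomP. Qed.

Lemma shom_addA F G : associative (@shom_add F G).
Proof. by move=> f g h; apply: shom_eq => s /=; rewrite addrA. Qed.

Lemma shom_addC F G : commutative (@shom_add F G).
Proof. by move=> f g; apply: shom_eq => s /=; rewrite addrC. Qed.

Lemma shom_add0 F G : left_id (@shom_zero F G) (@shom_add F G).
Proof. by move=> f; apply: shom_eq => s /=; rewrite add0r. Qed.

Lemma shom_addN F G : left_inverse (@shom_zero F G) (@shom_opp F G) (@shom_add F G).
Proof. by move=> f; apply: shom_eq => s /=; rewrite addNr. Qed.

HB.instance Definition _ F G := GRing.isZmodule.Build (sheaf_hom F G)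
  (@shom_addA F G) (@shom_addC F G) (@shom_add0 F G) (@shom_addN F G).

Program Definition shom_id F := @SheafHom d S V F F (fun s => idm (F s)) _.
Next Obligation. by move=> F s t h /=; rewrite comp1m compm1. Qed.

Program Definition shom_comp F G H (g : sheaf_hom G H) (f : sheaf_hom F G) :=
  @SheafHom d S V F H (fun s => g s ∘ f s) _.
Next Obligation.
by move=> F G H g f s t h /=; rewrite compA shomP -!compA shomP.
Qed.

Program Definition sheaf_cat : preadditive :=
  @Preadditive (sheaf S V) (fun F G => sheaf_hom F G) shom_id shom_comp _ _ _ _ _.
Next Obligation. by move=> A B C D h g f; apply: shom_eq => s /=; rewrite compA. Qed.
Next Obligation. by move=> A B f; apply: shom_eq => s /=; rewrite comp1m. Qed.
Next Obligation. by move=> A B f; apply: shom_eq => s /=; rewrite compm1. Qed.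
Next Obligation. by move=> A B C g g' f; apply: shom_eq => s /=; rewrite compDl. Qed.
Next Obligation. by move=> A B C g f f'; apply: shom_eq => s /=; rewrite compDr. Qed.

End SheafHom.

Record biproduct (V : preadditive) (A B : V) := Biproduct {
  bpo :> V;
  bpi1 : A ~> bpo;
  bpi2 : B ~> bpo;
  bpp1 : bpo ~> A;
  bpp2 : bpo ~> B;
  bpP : is_biproduct bpi1 bpi2 bpp1 bpp2 }.

Lemma bp_ext (V : preadditive) (A B : V) (P : biproduct A B) X (x y : X ~> P) :
  bpp1 P ∘ x = bpp1 P ∘ y -> bpp2 P ∘ x = bpp2 P ∘ y -> x = y.
Proof.
have [_ _ _ _ E] := bpP P => xy1 xy2.
by rewrite -(comp1m x) -E compDl -!compA xy1 xy2 !compA -compDl E comp1m.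
Qed.

Section SheafAbelian.
Context d (S : finPOrderType d) (V : abelian).
Implicit Types F G H : sheaf_cat S V.

Program Definition zero_sheaf : sheaf_cat S V :=
  @Sheaf d S V (fun s => zero_obj) (fun s t h => idm _) _ _.
Next Obligation. by []. Qed.
Next Obligation. by move=> *; rewrite /= comp1m. Qed.

Lemma zero_sheafP : is_zero zero_sheaf.
Proof.
move=> F; split=> f; apply: shom_eq => s; by have [h1 h2] := @zero_objP V (F s).
Qed.

Lemma ker_res_ex F G (f : F ~> G) s t (h : (s <= t)%O) :
  f t ∘ (res F h ∘ kerm (f s)) = 0.
Proof. by rewrite compA -shomP -compA ker0 compm0. Qed.

Program Definition ker_sheaf F G (f : F ~> G) : sheaf_cat S V :=
  @Sheaf d S V (fun s => ker (f s)) (fun s t h => ker_lift (ker_res_ex f h)) _ _.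
Next Obligation.
move=> F G f s h; apply: (@kerm_mono _ _ _ (f s)).
by rewrite ker_liftE res_id comp1m compm1.
Qed.
Next Obligation.
move=> F G f s t u h1 h2 h; apply: (@kerm_mono _ _ _ (f u)).
by rewrite compA !ker_liftE -compA ker_liftE compA (res_comp F h1 h2 h).
Qed.

Program Definition kerm_sheaf F G (f : F ~> G) : ker_sheaf f ~> F :=
  @SheafHom d S V (ker_sheaf f) F (fun s => kerm (f s)) _.
Next Obligation. by move=> F G f s t h /=; rewrite ker_liftE. Qed.

Lemma coker_res_ex F G (f : F ~> G) s t (h : (s <= t)%O) :
  (cokerm (f t) ∘ res G h) ∘ f s = 0.
Proof. by rewrite -compA shomP compA coker0 comp0m. Qed.

Program Definition coker_sheaf F G (f : F ~> G) : sheaf_cat S V :=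
  @Sheaf d S V (fun s => coker (f s)) (fun s t h => coker_lift (coker_res_ex f h)) _ _.
Next Obligation.
move=> F G f s h; apply: (@cokerm_epi _ _ _ (f s)).
by rewrite coker_liftE res_id comp1m compm1.
Qed.
Next Obligation.
move=> F G f s t u h1 h2 h; apply: (@cokerm_epi _ _ _ (f s)).
by rewrite -compA !coker_liftE compA coker_liftE -compA (res_comp G h1 h2 h).
Qed.

Program Definition cokerm_sheaf F G (f : F ~> G) : G ~> coker_sheaf f :=
  @SheafHom d S V G (coker_sheaf f) (fun s => cokerm (f s)) _.
Next Obligation. by move=> F G f s t h /=; rewrite coker_liftE. Qed.

Lemma mono_pw F G (f : F ~> G) : (forall s, mono (f s)) -> mono f.
Proof.
move=> fm X g h gh; apply: shom_eq => s; apply: fm.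
exact: (congr1 (fun u : sheaf_hom _ _ => u s) gh).
Qed.

Lemma epi_pw F G (f : F ~> G) : (forall s, epi (f s)) -> epi f.
Proof.
move=> fm X g h gh; apply: shom_eq => s; apply: fm.
exact: (congr1 (fun u : sheaf_hom _ _ => u s) gh).
Qed.

Lemma is_kernel_pw F G H (f : F ~> G) (k : H ~> F) :
  (forall s, is_kernel (f s) (k s)) -> is_kernel f k.
Proof.
move=> kP; have km s := is_kernel_mono (kP s).
apply: is_kernelI; first exact: mono_pw.
  by apply: shom_eq => s; have [E _] := kP s.
move=> X x /(congr1 (fun u : sheaf_hom _ _ => fun s => u s)) fx0.
have yE s : exists y, k s ∘ y = x s.
  have [_ /(_ (X s) (x s))[|y [yE _]]] := kP s; last by exists y.
  exact: (congr1 (fun u => u s) fx0).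
pose y s := projT1 (cid (yE s)).
have yP s : k s ∘ y s = x s := projT2 (cid (yE s)).
have yN s t (h : (s <= t)%O) : res H h ∘ y s = y t ∘ res X h.
  by apply: km; rewrite !compA -shomP -compA !yP shomP.
by exists (SheafHom yN); apply: shom_eq.
Qed.

Lemma is_cokernel_pw F G H (f : F ~> G) (k : G ~> H) :
  (forall s, is_cokernel (f s) (k s)) -> is_cokernel f k.
Proof.
move=> kP; have km s := is_cokernel_epi (kP s).
apply: is_cokernelI; first exact: epi_pw.
  by apply: shom_eq => s; have [E _] := kP s.
move=> X x /(congr1 (fun u : sheaf_hom _ _ => fun s => u s)) fx0.
have yE s : exists y, y ∘ k s = x s.
  have [_ /(_ (X s) (x s))[|y [yE _]]] := kP s; last by exists y.
  exact: (congr1 (fun u => u s) fx0).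
pose y s := projT1 (cid (yE s)).
have yP s : y s ∘ k s = x s := projT2 (cid (yE s)).
have yN s t (h : (s <= t)%O) : res X h ∘ y s = y t ∘ res H h.
  by apply: (km s); rewrite -!compA (shomP k) (compA (y t)) !yP (shomP x).
by exists (SheafHom yN); apply: shom_eq.
Qed.

Lemma kerm_sheafP F G (f : F ~> G) : is_kernel f (kerm_sheaf f).
Proof. by apply: is_kernel_pw => s; exact: kermP. Qed.

Lemma cokerm_sheafP F G (f : F ~> G) : is_cokernel f (cokerm_sheaf f).
Proof. by apply: is_cokernel_pw => s; exact: cokermP. Qed.

Lemma pw_mono F G (f : F ~> G) s : mono f -> mono (f s).
Proof.
move=> fm; apply: mono0 => X x /ker_lift_ex[y <-].
have E : kerm_sheaf f = 0.
  by apply: fm; rewrite compm0; have [] := kerm_sheafP f.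
have -> : kerm (f s) = 0 by exact: (congr1 (fun u : sheaf_hom _ _ => u s) E).
by rewrite comp0m.
Qed.

Lemma pw_epi F G (f : F ~> G) s : epi f -> epi (f s).
Proof.
move=> fm; apply: epi0 => X x /coker_lift_ex[y <-].
have E : cokerm_sheaf f = 0.
  by apply: fm; rewrite comp0m; have [] := cokerm_sheafP f.
have -> : cokerm (f s) = 0 by exact: (congr1 (fun u : sheaf_hom _ _ => u s) E).
by rewrite compm0.
Qed.

Lemma sheaf_biproduct F G :
  exists P (i1 : F ~> P) (i2 : G ~> P) p1 p2, is_biproduct i1 i2 p1 p2.
Proof.
have B s : exists P : biproduct (F s) (G s), True.
  by have [P [i1 [i2 [p1 [p2 H]]]]] := ab_biproduct (F s) (G s); exists (Biproduct H).
pose P s : biproduct (F s) (G s) := projT1 (cid (B s)).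
pose r s t (h : (s <= t)%O) : P s ~> P t :=
  bpi1 _ ∘ res F h ∘ bpp1 _ + bpi2 _ ∘ res G h ∘ bpp2 _.
have r1 s t (h : (s <= t)%O) : bpp1 _ ∘ r s t h = res F h ∘ bpp1 _.
  by have [E1 _ E3 _ _] := bpP (P t); rewrite /r compDr !compA E1 E3 !comp0m comp1m addr0.
have r2 s t (h : (s <= t)%O) : bpp2 _ ∘ r s t h = res G h ∘ bpp2 _.
  by have [_ E2 _ E4 _] := bpP (P t); rewrite /r compDr !compA E2 E4 !comp0m comp1m add0r.
have rid s h : r s s h = idm (P s).
  by apply: bp_ext; rewrite ?r1 ?r2 res_id comp1m compm1.
have rcomp s t u h1 h2 h : r t u h2 ∘ r s t h1 = r s u h.
  by apply: bp_ext; rewrite compA ?r1 ?r2 -compA ?r1 ?r2 compA (res_comp _ h1 h2 h).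
pose Q : sheaf_cat S V := Sheaf rid rcomp.
have i1P s t (h : (s <= t)%O) : res Q h ∘ bpi1 (P s) = bpi1 (P t) ∘ res F h.
  have [E1 _ _ E4 _] := bpP (P s).
  by rewrite /= /r compDl -!compA E1 E4 !compm0 compm1 addr0.
have i2P s t (h : (s <= t)%O) : res Q h ∘ bpi2 (P s) = bpi2 (P t) ∘ res G h.
  have [_ E2 E3 _ _] := bpP (P s).
  by rewrite /= /r compDl -!compA E2 E3 !compm0 compm1 add0r.
exists Q, (SheafHom i1P), (SheafHom i2P).
exists (@SheafHom d S V Q F (fun s => bpp1 (P s)) (fun s t h => esym (r1 s t h))).
exists (@SheafHom d S V Q G (fun s => bpp2 (P s)) (fun s t h => esym (r2 s t h))).
by split; apply: shom_eq => s; have [] := bpP (P s).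
Qed.

Lemma sheaf_mono_normal F G (f : F ~> G) :
  mono f -> exists Q (q : G ~> Q), is_kernel q f.
Proof.
move=> fm; exists (coker_sheaf f), (cokerm_sheaf f).
by apply: is_kernel_pw => s; exact/is_kernel_cokerm/pw_mono.
Qed.

Lemma sheaf_epi_normal F G (f : F ~> G) :
  epi f -> exists K (k : K ~> F), is_cokernel k f.
Proof.
move=> fm; exists (ker_sheaf f), (kerm_sheaf f).
by apply: is_cokernel_pw => s; exact/is_cokernel_kerm/pw_epi.
Qed.

Definition sheaves : abelian := @Abelian (sheaf_cat S V)
  (ex_intro _ zero_sheaf zero_sheafP) sheaf_biproduct
  (fun F G f => ex_intro _ _ (ex_intro _ _ (kerm_sheafP f)))
  (fun F G f => ex_intro _ _ (ex_intro _ _ (cokerm_sheafP f)))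
  sheaf_mono_normal sheaf_epi_normal.

Lemma exact_pw (A B X : sheaves) (f : A ~> B) (g : B ~> X) :
  exact f g <-> forall s, exact (f s) (g s).
Proof.
rewrite (exactP g (cokerm_sheafP f) (kerm_sheafP (cokerm_sheaf f))).
split=> [kP s|H]; last exact: (@is_kernel_pw _ _ _ g (kerm_sheaf (cokerm_sheaf f)) H).
have [i iE [j [ji ij]]] := @is_kernel_iso sheaves _ _ _ g _ kP.
have [i' iE' [j' [ji' ij']]] := @is_kernel_iso sheaves _ _ _ g _ (kerm_sheafP g).
pose a := j' ∘ i; pose b := j ∘ i'.
have ab : a ∘ b = idm _ by rewrite /a /b -compA (compA i) ij comp1m ji'.
have ba : b ∘ a = idm _ by rewrite /a /b -compA (compA i') ij' comp1m ji.
have aE : kerm_sheaf g ∘ a = kerm_sheaf (cokerm_sheaf f).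
  by rewrite /a -iE' -iE -compA (compA i') ij' comp1m.
rewrite /exact /imm.
have <- : kerm (g s) ∘ a s = kerm (cokerm (f s)).
  exact: (congr1 (fun u : sheaf_hom _ _ => u s) aE).
apply: is_kernel_compiso (kermP _); exists (b s); split.
  exact: (congr1 (fun u : sheaf_hom _ _ => u s) ba).
exact: (congr1 (fun u : sheaf_hom _ _ => u s) ab).
Qed.

End SheafAbelian.

Section FiniteProducts.
Context (V : abelian).

Definition is_product (I : Type) (A : I -> V) P (p : forall i, P ~> A i) :=
  forall X (x : forall i, X ~> A i), exists! y, forall i, p i ∘ y = x i.

Lemma product_seq (I : eqType) (A : I -> V) (s : seq I) :
  exists P (p : forall i, P ~> A i),
    (forall X (x : forall i, X ~> A i),
       exists y, forall i, i \in s -> p i ∘ y = x i) /\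
    (forall X (y z : X ~> P), (forall i, i \in s -> p i ∘ y = p i ∘ z) -> y = z).
Proof.
elim: s => [|a s [P [p [pE pU]]]].
  exists zero_obj, (fun i => 0); split=> [X x|X y z _]; first by exists 0.
  by rewrite (proj1 (zero_objP X) y) (proj1 (zero_objP X) z).
have [Q [i1 [i2 [p1 [p2 Qb]]]]] := ab_biproduct (A a) P.
pose B := Biproduct Qb.
have [as_|as_] := boolP (a \in s).
  exists P, p; split=> [X x|X y z yz].
    have [y yE] := pE X x; exists y => i; rewrite inE.
    by case/predU1P => [->|]; exact: yE.
  by apply: pU => i is_; apply: yz; rewrite inE is_ orbT.
pose q i : Q ~> A i := match eqVneq i a with
  | EqNotNeq e => ecast k (Q ~> A k) (esym e) p1
  | NeqNotEq _ => p i ∘ p2 end.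
have qa : q a = p1.
  rewrite /q; case: eqVneq => [e|]; last by rewrite eqxx.
  by rewrite eq_axiomK.
have qs i : i \in s -> q i = p i ∘ p2.
  by rewrite /q; case: eqVneq => // e is_; case/negP: as_; rewrite -e.
have [E1 E2 E3 E4 _] := Qb.
exists Q, q; split=> [X x|X y z yz].
  have [y yE] := pE X x; exists (i1 ∘ x a + i2 ∘ y) => i.
  rewrite inE => /predU1P[->|is_].
    by rewrite qa compDr !compA E1 E3 comp0m comp1m addr0.
  rewrite qs // -compA compDr !compA; rewrite E2 E4 comp0m comp1m add0r.
  exact: yE.
apply: (@bp_ext _ _ _ B).
  by have := yz a; rewrite inE eqxx qa => /(_ isT).
apply: pU => i is_; rewrite !compA -qs //.
by apply: yz; rewrite inE is_ orbT.
Qed.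

Lemma product_ex (I : finType) (A : I -> V) :
  exists p : {P : V & forall i, P ~> A i}, is_product (projT2 p).
Proof.
have [P [p [pE pU]]] := product_seq A (enum I).
exists (existT _ P p) => X x; have [y yE] := pE X x; exists y; split=> [i|z zE].
  by apply: yE; rewrite mem_enum.
by apply: pU => i _; rewrite zE yE // mem_enum.
Qed.

Section Product.
Context (I : finType) (A : I -> V).

Definition prod : V := projT1 (projT1 (cid (product_ex A))).
Definition proj : forall i, prod ~> A i := projT2 (projT1 (cid (product_ex A))).

Lemma projP : is_product proj.
Proof. exact: (projT2 (cid (product_ex A))). Qed.

Lemma prod_lift X (x : forall i, X ~> A i) : exists y, forall i, proj i ∘ y = x i.
Proof. by have [y [yE _]] := projP x; exists y. Qed.

Lemma prod_ext X (x y : X ~> prod) : (forall i, proj i ∘ x = proj i ∘ y) -> x = y.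
Proof.
move=> xy; have [z [_ zU]] := projP (fun i => proj i ∘ x).
by rewrite -(zU x) // -(zU y).
Qed.

End Product.
End FiniteProducts.

Section EnoughInjectiveSheaves.
Context d (S : finPOrderType d) (V : abelian) (inj : enough_injectives V).

Lemma prod_injective (I : finType) (A : I -> V) :
  (forall i, injective_obj (A i)) -> injective_obj (prod A).
Proof.
move=> Ainj X Y m f mm.
have gE i : exists g, g ∘ m = proj A i ∘ f by apply: Ainj.
have [g gP] := prod_lift (fun i => projT1 (cid (gE i))).
by exists g; apply: prod_ext => i; rewrite compA gP (projT2 (cid (gE i))).
Qed.

(* F embeds in the sheaf t |-> \prod_(s >= t) hull (F s). *)
Lemma sheaves_enough_injectives : enough_injectives (sheaves S V).
Proof.
move=> F; pose U t : finType := {s : S | (t <= s)%O}.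
pose J t := prod (fun u : U t => hull inj (F (val u))).
pose pj t (s : S) (h : (t <= s)%O) : J t ~> hull inj (F s) :=
  proj (fun u : U t => hull inj (F (val u))) (exist _ s h).
have Jext t X (x y : X ~> J t) :
    (forall s h, pj t s h ∘ x = pj t s h ∘ y) -> x = y.
  by move=> xy; apply: prod_ext => -[s h]; exact: xy.
have Jlift t X (x : forall s, (t <= s)%O -> X ~> hull inj (F s)) :
    exists y, forall s h, pj t s h ∘ y = x s h.
  have [y yE] := @prod_lift V (U t) (fun u : U t => hull inj (F (val u))) X
    (fun u => x (val u) (valP u)).
  exists y => s h; apply: etrans (yE (exist _ s h)) _ => /=; congr x; exact: bool_irrelevance.
have rE t t' (h : (t <= t')%O) :
    exists y : J t ~> J t', forall s k, pj t' s k ∘ y = pj t s (le_trans h k).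
  exact: Jlift (fun s k => pj t s (le_trans h k)).
pose r t t' h : J t ~> J t' := projT1 (cid (rE t t' h)).
have rP t t' h s k k' : pj t' s k ∘ r t t' h = pj t s k'.
  by rewrite (projT2 (cid (rE t t' h))); congr pj; exact: bool_irrelevance.
have rid t h : r t t h = idm (J t).
  by apply: Jext => s k; rewrite rP compm1.
have rcomp s t u h1 h2 h : r t u h2 ∘ r s t h1 = r s u h.
  apply: Jext => v k; rewrite compA (rP _ _ _ _ _ (le_trans h2 k)).
  by rewrite (rP _ _ _ _ _ (le_trans h k)) (rP _ _ _ _ _ (le_trans h k)).
pose G : sheaves S V := Sheaf rid rcomp.
have mE t : exists y : F t ~> G t, forall s h, pj t s h ∘ y = emb inj (F s) ∘ res F h.
  exact: Jlift (fun s h => emb inj (F s) ∘ res F h).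
pose m t := projT1 (cid (mE t)).
have mP t s h : pj t s h ∘ m t = emb inj (F s) ∘ res F h := projT2 (cid (mE t)) s h.
have mN s t (h : (s <= t)%O) : res G h ∘ m s = m t ∘ res F h.
  apply: Jext => u k; rewrite !compA mP (rP _ _ _ _ _ (le_trans h k)) mP.
  by rewrite -compA (res_comp F h k (le_trans h k)).
exists G, (SheafHom mN); split.
  apply: mono_pw => t; apply: mono0 => X x /= mx0.
  have /(congr1 (comp (pj t t (lexx t)))) := mx0.
  rewrite compA mP res_id compm1 compm0 => ex0.
  by apply: (@emb_mono _ inj (F t)); rewrite ex0 compm0.
move=> A B n f /pw_mono nm.
have gE s : exists g, g ∘ n s = pj s s (lexx s) ∘ f s.
  exact: (@hull_inj _ inj (F s) _ _ (n s) (pj s s (lexx s) ∘ f s) (nm s)).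
pose g s := projT1 (cid (gE s)).
have gP s : g s ∘ n s = pj s s (lexx s) ∘ f s := projT2 (cid (gE s)).
have qE t : exists y : B t ~> G t, forall s h, pj t s h ∘ y = g s ∘ res B h.
  exact: Jlift (fun s h => g s ∘ res B h).
pose q t := projT1 (cid (qE t)).
have qP t s h : pj t s h ∘ q t = g s ∘ res B h := projT2 (cid (qE t)) s h.
have qN s t (h : (s <= t)%O) : res G h ∘ q s = q t ∘ res B h.
  apply: Jext => u k; rewrite !compA qP (rP _ _ _ _ _ (le_trans h k)) qP.
  by rewrite -compA (res_comp B h k (le_trans h k)).
exists (SheafHom qN); apply: shom_eq => t; apply: Jext => s h /=.
rewrite compA qP -compA (shomP n) compA gP -compA -(shomP f) compA /=.
by rewrite (rP _ _ _ _ _ h).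
Qed.

End EnoughInjectiveSheaves.

Section GlobalSections.
Context d (S : finPOrderType d) (V : abelian).
Implicit Types F G : sheaves S V.

Definition is_cone F X (x : forall s, X ~> F s) :=
  forall s t (le_st : (s <= t)%O), res F le_st ∘ x s = x t.

Definition is_limit F L (p : forall s, L ~> F s) :=
  is_cone p /\
  forall X (x : forall s, X ~> F s), is_cone x -> exists! y, forall s, p s ∘ y = x s.

Lemma limit_ex F : exists p : {L : V & forall s, L ~> F s}, is_limit (projT2 p).
Proof.
pose J : finType := {u : S * S | (u.1 <= u.2)%O}.
have [m mP] := @prod_lift V J (fun u => F (val u).2) (prod F)
  (fun u => res F (valP u) ∘ proj F (val u).1 - proj F (val u).2).
exists (existT (fun L : V => forall s : S, L ~> F s) (ker m) (fun s => proj F s ∘ kerm m)); split=> [s t h|X x xP] /=.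
  have := mP (exist _ (s, t) h) => /= /(congr1 (fun u => u ∘ kerm m)).
  rewrite -compA ker0 compm0 compBl compA => /esym/eqP; rewrite subr_eq0 => /eqP <-.
  by congr (res F _ ∘ _ ∘ _); exact: bool_irrelevance.
have [y yP] := prod_lift x.
have my0 : m ∘ y = 0.
  apply: prod_ext => u; rewrite compm0 compA mP compBl -compA !yP.
  by rewrite xP subrr.
exists (ker_lift my0); split=> [s|z zP].
  by rewrite -compA ker_liftE yP.
apply: (@kerm_mono _ _ _ m); rewrite ker_liftE; apply: prod_ext => s.
by rewrite yP compA zP.
Qed.

(* The limit of F over S. *)
Definition gamma_obj F : V := projT1 (projT1 (cid (limit_ex F))).
Definition gamma_proj F : forall s, gamma_obj F ~> F s :=
  projT2 (projT1 (cid (limit_ex F))).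

Lemma gamma_projP F : is_limit (@gamma_proj F).
Proof. exact: (projT2 (cid (limit_ex F))). Qed.

Lemma gamma_cone F s t (h : (s <= t)%O) :
  res F h ∘ gamma_proj F s = gamma_proj F t.
Proof. by have [E _] := gamma_projP F; exact: E. Qed.

Lemma gamma_lift_ex F X (x : forall s, X ~> F s) :
  is_cone x -> exists y, forall s, gamma_proj F s ∘ y = x s.
Proof.
by move=> xP; have [_ /(_ X x xP)[y [yE _]]] := gamma_projP F; exists y.
Qed.

Definition gamma_lift F X (x : forall s, X ~> F s) (xP : is_cone x) :
  X ~> gamma_obj F := projT1 (cid (gamma_lift_ex xP)).

Lemma gamma_liftE F X (x : forall s, X ~> F s) (xP : is_cone x) s :
  gamma_proj F s ∘ gamma_lift xP = x s.
Proof. exact: (projT2 (cid (gamma_lift_ex xP)) s). Qed.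

Lemma gamma_ext F X (x y : X ~> gamma_obj F) :
  (forall s, gamma_proj F s ∘ x = gamma_proj F s ∘ y) -> x = y.
Proof.
move=> xy; have [_ /(_ X (fun s => gamma_proj F s ∘ x))[|z [_ zU]]] := gamma_projP F.
  by move=> s t h; rewrite compA gamma_cone.
by rewrite -(zU x) // -(zU y).
Qed.

Lemma gamma_hom_cone F G (f : F ~> G) : is_cone (fun s => f s ∘ gamma_proj F s).
Proof. by move=> s t h; rewrite compA (shomP f) -compA gamma_cone. Qed.

Definition gamma_hom F G (f : F ~> G) : gamma_obj F ~> gamma_obj G :=
  gamma_lift (gamma_hom_cone f).

Program Definition gamma : functor (sheaves S V) V :=
  @Functor (sheaves S V) V gamma_obj gamma_hom _ _ _.
Next Obligation.
by move=> F; apply: gamma_ext => s; rewrite gamma_liftE comp1m compm1.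
Qed.
Next Obligation.
move=> A B X g f; apply: gamma_ext => s.
by rewrite compA !gamma_liftE -!compA gamma_liftE.
Qed.
Next Obligation.
move=> A B f g; apply: gamma_ext => s.
by rewrite compDr !gamma_liftE compDl.
Qed.

Program Definition const_sheaf (X : V) : sheaves S V :=
  @Sheaf d S V (fun s => X) (fun s t h => idm X) _ _.
Next Obligation. by []. Qed.
Next Obligation. by move=> *; rewrite /= comp1m. Qed.

Lemma gamma_left_exact : left_exact gamma.
Proof.
move=> A B K f k kP; have [fk0 kU] := kP; apply: is_kernelI.
- move=> X x y xy; apply: gamma_ext => s.
  have ks := @pw_mono d S V K A k s (is_kernel_mono kP); apply: ks.
  by rewrite !compA -!(gamma_liftE (gamma_hom_cone k)) -!compA; congr (_ ∘ _).
- by rewrite -fmapM fk0 fmap0.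
move=> X x fx0.
have xN s t (h : (s <= t)%O) :
    res A h ∘ (gamma_proj A s ∘ x) = (gamma_proj A t ∘ x) ∘ res (const_sheaf X) h.
  by rewrite /= compm1 compA gamma_cone.
pose x' : const_sheaf X ~> A := @SheafHom d S V (const_sheaf X) A _ xN.
have [|y [yE _]] := kU _ x'.
  apply: shom_eq => s /=; rewrite compA -(gamma_liftE (gamma_hom_cone f)) -compA.
  by rewrite -/(gamma_hom f) [gamma_hom f ∘ x]fx0 compm0.
have yP : is_cone y by move=> s t h; rewrite (shomP y) /= compm1.
exists (gamma_lift yP); apply: gamma_ext => s.
rewrite compA gamma_liftE -compA gamma_liftE.
exact: (congr1 (fun u : sheaf_hom _ _ => u s) yE).
Qed.

End GlobalSections.

Section Restriction.
Context d (S : finPOrderType d) (V : abelian).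

Definition subposet (A : {set S}) := {x : S | x \in A}.

HB.instance Definition _ (A : {set S}) := SubFinite.on (subposet A).
HB.instance Definition _ (A : {set S}) :=
  [SubChoice_isSubPOrder of subposet A by <: with d].

Context (A : {set S}).

Program Definition restrict_obj (F : sheaves S V) : sheaves (subposet A) V :=
  @Sheaf d (subposet A) V (fun x => F (val x))
    (fun x y (le_xy : (x <= y)%O) => @res d S V F (val x) (val y) le_xy) _ _.
Next Obligation. by move=> F x h; exact: res_id. Qed.
Next Obligation. by move=> F x y z h1 h2 h; exact: res_comp. Qed.

Program Definition restrict_hom (F G : sheaves S V) (f : F ~> G) :
    restrict_obj F ~> restrict_obj G :=
  @SheafHom d (subposet A) V (restrict_obj F) (restrict_obj G)
    (fun x => f (val x)) _.
Next Obligation. by move=> F G f x y h /=; rewrite (shomP f). Qed.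

Program Definition restriction : functor (sheaves S V) (sheaves (subposet A) V) :=
  @Functor (sheaves S V) (sheaves (subposet A) V) restrict_obj restrict_hom _ _ _.
Next Obligation. by move=> F; apply: shom_eq. Qed.
Next Obligation. by move=> F G H g f; apply: shom_eq. Qed.
Next Obligation. by move=> F G f g; apply: shom_eq. Qed.

Lemma restriction_exact : exact_functor restriction.
Proof. by move=> F G H f g /exact_pw fg; apply/exact_pw => x; exact: fg. Qed.

Lemma gamma_res_cone (F : sheaves S V) :
  @is_cone d (subposet A) V (restriction F) _ (fun x => gamma_proj F (val x)).
Proof. by move=> x y h; exact: gamma_cone. Qed.

Definition gamma_res_fun (F : sheaves S V) :
    gamma S V F ~> functor_comp (gamma (subposet A) V) restriction F :=
  gamma_lift (gamma_res_cone F).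

Lemma gamma_res_nat (F G : sheaves S V) (f : F ~> G) :
  fmap (functor_comp (gamma (subposet A) V) restriction) f ∘ gamma_res_fun F =
  gamma_res_fun G ∘ fmap (gamma S V) f.
Proof.
apply: gamma_ext => x; rewrite !compA !gamma_liftE -compA.
by rewrite gamma_liftE.
Qed.

Definition gamma_res : nat_trans (gamma S V)
    (functor_comp (gamma (subposet A) V) restriction) :=
  NatTrans gamma_res_nat.

End Restriction.

(* H^j(S, -): right derived functors of global sections on all sheaves on S. *)
Definition cohomology d (S : finPOrderType d) (V : abelian)
    (inj : enough_injectives V) (j : nat) : functor (sheaves S V) V :=
  derived (@sheaves_enough_injectives d S V inj) (gamma S V) j.

Definition cohomology_res d (S : finPOrderType d) (V : abelian)
    (inj : enough_injectives V) (A : {set S}) (j : nat) :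
    nat_trans (cohomology S inj j)
      (functor_comp (cohomology (subposet A) inj j) (restriction V A)) :=
  derived_map (@sheaves_enough_injectives d S V inj)
    (@sheaves_enough_injectives d (subposet A) V inj)
    (@restriction_exact d S V A) (gamma_res V A) j.

(* The maps cohomology_res form the morphism of delta-functors extending the *)
(* restriction of global sections, modulo the identification of H^0 with     *)
(* global sections.                                                          *)
Section CohomologyRes.
Context d (S : finPOrderType d) (V : abelian) (inj : enough_injectives V).

Definition cohomology0 (F : sheaves S V) : gamma S V F ~> cohomology S inj 0 F :=
  derived_aug (@sheaves_enough_injectives d S V inj) (gamma S V) F.

Lemma cohomology0_iso (F : sheaves S V) : is_iso (cohomology0 F).
Proof. exact/derived_aug_iso/gamma_left_exact. Qed.

Definition cohomology_connecting (j : nat) (F G H : sheaves S V)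
    (f : F ~> G) (g : G ~> H) (fg : short_exact f g) :
    cohomology S inj j H ~> cohomology S inj j.+1 F :=
  connecting (@sheaves_enough_injectives d S V inj) (gamma S V) j fg.

End CohomologyRes.

Lemma cohomology_res0 d (S : finPOrderType d) (V : abelian)
    (inj : enough_injectives V) (A : {set S}) (F : sheaves S V) :
  cohomology_res inj A 0 F ∘ cohomology0 inj F =
  cohomology0 inj (restriction V A F) ∘ gamma_res V A F.
Proof. exact: derived_map_aug. Qed.

Lemma cohomology_res_connecting d (S : finPOrderType d) (V : abelian)
    (inj : enough_injectives V) (A : {set S}) (j : nat) (F G H : sheaves S V)
    (f : F ~> G) (g : G ~> H) (fg : short_exact f g) :
  cohomology_res inj A j.+1 F ∘ cohomology_connecting inj j fg =
  cohomology_connecting inj j (exact_functor_short (@restriction_exact d S V A) fg)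
    ∘ cohomology_res inj A j H.
Proof. exact: derived_map_connecting. Qed.

Section Beat.
Context d (S : finPOrderType d) (V : abelian).

Definition downbeat (v : S) :=
  exists a : S, (a < v)%O /\ forall b : S, (b < v)%O -> (b <= a)%O.

Definition upbeat (F : sheaves S V) (v : S) :=
  exists (a : S) (lt_va : (v < a)%O),
    (forall b : S, (v < b)%O -> (a <= b)%O) /\ is_iso (res F (ltW lt_va)).

Definition beat (F : sheaves S V) (v : S) := upbeat F v \/ downbeat v.

End Beat.

(* Main.v *)
Require Import Defs.
From mathcomp Require Import all_boot all_order.
From mathcomp Require Import ssralg boolp.

Set Implicit Arguments.
Unset Strict Implicit.
Unset Printing Implicit Defensive.

Import Order.TTheory GRing.Theory.
(* [Defs] again, so that its [compA] is not hidden by the one of [ssrfun]. *)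
Import Defs.
Local Open Scope ring_scope.
Local Open Scope cat_scope.

#[local] Obligation Tactic := idtac.

(** Deleting [v] admits a monotone retraction [rho : S -> S'], sending [v] to
the element [a] that witnesses the beat condition. Pulling back along [rho] is
an exact functor, left adjoint to restriction for a downbeat and right adjoint
to it for an upbeat. In the downbeat case restriction therefore preserves
injectives, and global sections on [S] and [S'] agree for every sheaf. In the
upbeat case the pullback preserves injectives and the unit at [F] is an
isomorphism, so [F] is resolved by pullbacks of an injective resolution of its
restriction. In both cases [F] has an injective resolution that stays injective
on [S'] and has the same global sections there. *)

(** * Isomorphisms, retracts of injectives, and their effect on resolutions and cohomology *)

Section Isomorphisms.
Context {C : preadditive}.

Lemma is_iso_id (A : C) : is_iso (idm A).
Proof. by exists (idm A); rewrite comp1m. Qed.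

Lemma is_iso_comp (A B X : C) (g : B ~> X) (f : A ~> B) :
  is_iso g -> is_iso f -> is_iso (g ∘ f).
Proof.
move=> [g' [g'g gg']] [f' [f'f ff']]; exists (f' ∘ g'); split.
  by rewrite -compA (compA g') g'g comp1m.
by rewrite -compA (compA f) ff' comp1m.
Qed.

Lemma is_iso_mono (A B : C) (f : A ~> B) : is_iso f -> mono f.
Proof.
by move=> [f' [f'f _]] X g h /(congr1 (comp f')); rewrite !compA f'f !comp1m.
Qed.

Lemma is_iso_epi (A B : C) (f : A ~> B) : is_iso f -> epi f.
Proof.
move=> [f' [_ ff']] X g h /(congr1 (fun u => u ∘ f')).
by rewrite -!compA ff' !compm1.
Qed.

Lemma injective_retract (I J : C) (p : I ~> J) (i : J ~> I) :
  p ∘ i = idm J -> injective_obj I -> injective_obj J.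
Proof.
move=> pi Iinj A B m f mm; have [g gm] := Iinj A B m (i ∘ f) mm.
by exists (p ∘ g); rewrite -compA gm compA pi comp1m.
Qed.

End Isomorphisms.

(** Precomposition with an epimorphism changes neither the cokernel of [e] nor, therefore, its
    image. *)
Lemma is_resolution_compiso (C : abelian) (A B : C) (X : complex C)
    (e : A ~> X 0) (i : B ~> A) :
  is_iso i -> is_resolution e -> is_resolution (e ∘ i).
Proof.
move=> ii [em e0 Xex]; split=> //; first exact: mono_comp (is_iso_mono ii).
have cP := is_cokernel_comp_epi (is_iso_epi ii) (cokermP e).
exact/(exactP _ cP (kermP _)).
Qed.

(** The degreewise inverses commute with the differentials because [f] does, so they form a chain
    map. *)
Lemma cohom_map_iso (C : abelian) (X Y : complex C) (f : cmap X Y) n :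
  (forall k, is_iso (f k)) -> is_iso (cohom_map f n).
Proof.
move=> fi; pose g k := projT1 (cid (fi k)).
have [gf fg] : (forall k, g k ∘ f k = idm _) /\ (forall k, f k ∘ g k = idm _).
  by split=> k; have [] := projT2 (cid (fi k)).
have gP k : cdiff X k ∘ g k = g k.+1 ∘ cdiff Y k.
  by rewrite -[LHS]comp1m -gf -!compA (compA (f _)) -(cmapP f) -!compA fg compm1.
exists (cohom_map (CMap gP) n); split; rewrite -cohom_map_comp -cohom_map_id.
  by congr (cohom_map _ n); apply: cmap_eq => k /=; rewrite gf.
by congr (cohom_map _ n); apply: cmap_eq => k /=; rewrite fg.
Qed.

(** * Derived functors from an arbitrary injective resolution *)

Section ComputeDerived.
Context {C D : abelian} (T : functor C D).

Lemma fcmap_id (X : complex C) : fcmap T (cmap_id X) = cmap_id (fcomplex T X).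
Proof. by apply: cmap_eq => k /=; rewrite fmap1. Qed.

Lemma fcmap_comp (X Y Z : complex C) (g : cmap Y Z) (f : cmap X Y) :
  fcmap T (cmap_comp g f) = cmap_comp (fcmap T g) (fcmap T f).
Proof. by apply: cmap_eq => k /=; rewrite fmapM. Qed.

(** The identity of [A] also lifts to a map from [Y] to [X]. Both composites with [phi] lift the
    identity, so they are homotopic to identities, and [T] preserves homotopies. *)
Lemma resolution_cohom_iso (A : C) (X Y : complex C) (eX : A ~> X 0)
    (eY : A ~> Y 0) (phi : cmap X Y) n :
  is_resolution eX -> (forall k, injective_obj (X k)) ->
  is_resolution eY -> (forall k, injective_obj (Y k)) ->
  phi 0 ∘ eX = eY -> is_iso (cohom_map (fcmap T phi) n).
Proof.
move=> Xres Xinj Yres Yinj phiE.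
have dX : cdiff X 0 ∘ eX = 0 by have [_ /exact0] := Xres.
have [psi psiE] := comparison (idm A) Yres Xinj dX.
exists (cohom_map (fcmap T psi) n).
rewrite -!cohom_map_comp -!fcmap_comp -!cohom_map_id -!fcmap_id.
split; apply/cohom_map_homotopic/fcmap_homotopic.
- apply: (comparison_homotopic Xres) => //=.
  by rewrite -compA phiE psiE compm1 comp1m.
- apply: (comparison_homotopic Yres) => //=.
  by rewrite -compA psiE compm1 phiE comp1m.
Qed.

End ComputeDerived.

(** [derived_map] is built from the chosen resolutions. On cohomology it factors through [X]: from
    [ires inj A] to [X], then along [r], then from [E X] to [ires inj' (E A)]. The outer maps
    compare injective resolutions, and the middle one is invertible in each degree. *)
Lemma derived_map_iso (C C' D : abelian) (inj : enough_injectives C)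
    (inj' : enough_injectives C') (T : functor C D) (T' : functor C' D)
    (E : functor C C') (Eex : exact_functor E)
    (r : nat_trans T (functor_comp T' E))
    (A : C) (X : complex C) (e : A ~> X 0) n :
  is_resolution e -> (forall k, injective_obj (X k)) ->
  (forall k, injective_obj (E (X k))) -> (forall k, is_iso (r (X k))) ->
  is_iso (derived_map inj inj' Eex r n A).
Proof.
move=> Xres Xinj EXinj rX; set I := ires inj A; set I' := ires inj' (E A).
pose rc (K : complex C) : cmap (fcomplex T K) (fcomplex T' (fcomplex E K)) :=
  @CMap _ (fcomplex T K) (fcomplex T' (fcomplex E K))
    (fun k => r (K k)) (fun k => ntransP r (cdiff K k)).
have dX : cdiff X 0 ∘ e = 0 by have [_ /exact0] := Xres.
have [psi psiE] := comparison (idm A) (iresP I) Xinj dX.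
rewrite compm1 in psiE.
have EXres := exact_functor_resolution Eex Xres.
have [chi chiE] := comparison (idm (E A)) EXres (@iinj _ _ I') (iaug0 I').
rewrite compm1 in chiE.
have -> : derived_map inj inj' Eex r n A =
    cohom_map (fcmap T' chi) n ∘ cohom_map (rc X) n ∘ cohom_map (fcmap T psi) n.
  rewrite -!cohom_map_comp.
  (* Naturality of [r] moves it to the right, past [psi]. *)
  have -> : cmap_comp (cmap_comp (fcmap T' chi) (rc X)) (fcmap T psi) =
      cmap_comp (fcmap T' (cmap_comp chi (fcmap E psi))) (rc I).
    apply: cmap_eq => k /=; rewrite fmapM -!compA; congr (_ ∘ _).
    exact/esym/(ntransP r).
  transitivity (cohom_map (cmap_comp
      (fcmap T' (base_change inj inj' Eex A)) (rc I)) n).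
    by rewrite /= /derived_map_fun; congr (cohom_map _ n); apply: cmap_eq.
  rewrite !cohom_map_comp; congr (_ ∘ _).
  (* Both chain maps from [E I] to [I'] lift the identity of [E A]. *)
  apply/cohom_map_homotopic/fcmap_homotopic.
  apply: (comparison_homotopic (exact_functor_resolution Eex (iresP I))).
    exact: iinj.
  by rewrite base_changeE /= -compA -fmapM psiE chiE.
apply: is_iso_comp; first apply: is_iso_comp.
- exact: (resolution_cohom_iso _ _ EXres EXinj (iresP I') (@iinj _ _ I')).
- exact: cohom_map_iso.
- exact: (resolution_cohom_iso _ _ (iresP I) (@iinj _ _ I) Xres Xinj).
Qed.

(** * Isomorphisms of sheaves and pullback along a monotone map *)

Lemma sheaf_iso_pw d (S : finPOrderType d) (V : abelian) (F G : sheaves S V)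
    (f : F ~> G) : (forall s, is_iso (f s)) -> is_iso f.
Proof.
move=> fi; pose g s := projT1 (cid (fi s)).
have [gf fg] : (forall s, g s ∘ f s = idm _) /\ (forall s, f s ∘ g s = idm _).
  by split=> s; have [] := projT2 (cid (fi s)).
have gP s t (h : (s <= t)%O) : res F h ∘ g s = g t ∘ res G h.
  by rewrite -[LHS]comp1m -gf -!compA (compA (f t)) -(shomP f) -!compA fg compm1.
by exists (@SheafHom d S V G F g gP); split; apply: shom_eq => s; rewrite /= ?gf ?fg.
Qed.

Lemma res_iso_eq d (S : finPOrderType d) (V : preadditive) (F : sheaf S V)
    (s t : S) (h : (s <= t)%O) : s = t -> is_iso (res F h).
Proof. by move=> st; subst t; rewrite res_id; exact: is_iso_id. Qed.

Section Pullback.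
Context d d' (S : finPOrderType d) (P : finPOrderType d') (V : abelian).
Context (rho : S -> P) (rhoM : {homo rho : s t / (s <= t)%O}).

Program Definition pullback_obj (G : sheaves P V) : sheaves S V :=
  @Sheaf d S V (fun s => G (rho s)) (fun s t h => res G (rhoM h)) _ _.
Next Obligation. by move=> G s h; exact: res_id. Qed.
Next Obligation. by move=> G s t u h1 h2 h; exact: res_comp. Qed.

Program Definition pullback_hom (G H : sheaves P V) (f : G ~> H) :
    pullback_obj G ~> pullback_obj H :=
  @SheafHom d S V (pullback_obj G) (pullback_obj H) (fun s => f (rho s)) _.
Next Obligation. by move=> G H f s t h /=; rewrite (shomP f). Qed.

Program Definition pullback : functor (sheaves P V) (sheaves S V) :=
  @Functor (sheaves P V) (sheaves S V) pullback_obj pullback_hom _ _ _.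
Next Obligation. by move=> F; apply: shom_eq. Qed.
Next Obligation. by move=> F G H g f; apply: shom_eq. Qed.
Next Obligation. by move=> F G f g; apply: shom_eq. Qed.

Lemma pullback_exact : exact_functor pullback.
Proof. by move=> F G H f g /exact_pw fg; apply/exact_pw => x; exact: fg. Qed.

End Pullback.

(** * Restriction to a monotone retract: global sections and injectives *)

Section Retraction.
Context d (S : finPOrderType d) (V : abelian) (A : {set S}).
Context (rho : S -> subposet A) (rhoM : {homo rho : s t / (s <= t)%O}).
Context (rhoK : cancel val rho).

Local Notation E := (restriction V A).
Local Notation R := (pullback V rhoM).

(** [rho (val x)] equals [x] only propositionally, so the stalks at these points are compared by
    restriction maps along this inequality and the next one. *)
Lemma retract_le (x : subposet A) : (rho (val x) <= x)%O.
Proof. by rewrite rhoK. Qed.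

Lemma retract_ge (x : subposet A) : (x <= rho (val x))%O.
Proof. by rewrite rhoK. Qed.

(** A section on [A] extends to [S]: its value at [s] is the image under [c s] of its value at
    [rho s]. The first hypothesis on [c] gives the left inverse law, the second the right one. *)
Lemma gamma_res_iso (Y : sheaves S V) (c : R (E Y) ~> Y) :
  (forall s, c s ∘ gamma_proj Y (val (rho s)) = gamma_proj Y s) ->
  (forall x : subposet A, c (val x) = res (E Y) (retract_le x)) ->
  is_iso (gamma_res V A Y).
Proof.
move=> cP cE.
have kP : is_cone (fun s => c s ∘ gamma_proj (E Y) (rho s)).
  move=> s t h; rewrite compA (shomP c) /= -compA; congr (_ ∘ _).
  exact: (@gamma_cone d (subposet A) V (E Y) _ _ (rhoM h)).
exists (gamma_lift kP); split; apply: gamma_ext => s.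
  by rewrite compA gamma_liftE -compA gamma_liftE cP compm1.
rewrite compA gamma_liftE gamma_liftE cE compm1.
exact: gamma_cone.
Qed.

Section Below.
Hypothesis rho_le : forall s, (val (rho s) <= s)%O.

Lemma below_gamma_res_iso (Y : sheaves S V) : is_iso (gamma_res V A Y).
Proof.
have cN s t (h : (s <= t)%O) :
    res Y h ∘ res Y (rho_le s) = res Y (rho_le t) ∘ res (R (E Y)) h.
  rewrite /= (res_comp Y _ _ (le_trans (rho_le s) h)).
  exact/esym/res_comp.
apply: (@gamma_res_iso Y (@SheafHom d S V (R (E Y)) Y _ cN)) => [s|x] /=.
  exact: gamma_cone.
by congr (@res d S V Y _ _ _); exact: bool_irrelevance.
Qed.

(* Restriction is right adjoint to the exact functor [R]. *)
Lemma below_restriction_injective (I : sheaves S V) :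
  injective_obj I -> injective_obj (E I).
Proof.
move=> Iinj G H m f mm.
have fN s t (h : (s <= t)%O) : res I h ∘ (res I (rho_le s) ∘ f (rho s)) =
    (res I (rho_le t) ∘ f (rho t)) ∘ res (R G) h.
  rewrite compA (res_comp I _ _ (le_trans (rho_le s) h)) -compA /= -(shomP f).
  by rewrite compA /=; congr (_ ∘ _); exact/esym/res_comp.
have Rm := exact_functor_mono (pullback_exact rhoM) mm.
have [g gE] := Iinj _ _ _ (@SheafHom d S V (R G) I _ fN) Rm.
have gN (x y : subposet A) (h : (x <= y)%O) :
    res (E I) h ∘ (g (val x) ∘ res H (retract_ge x)) =
    (g (val y) ∘ res H (retract_ge y)) ∘ res H h.
  rewrite compA /= (shomP g) -!compA /=; congr (_ ∘ _).
  by rewrite !(res_comp H _ _ (le_trans (retract_ge x) (rhoM h))).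
exists (@SheafHom d (subposet A) V H (E I) _ gN); apply: shom_eq => x /=.
rewrite -compA (shomP m) compA.
have -> : g (val x) ∘ m (rho (val x)) =
    res I (rho_le (val x)) ∘ f (rho (val x)).
  exact: (congr1 (fun u : sheaf_hom _ _ => u (val x)) gE).
rewrite -compA -(shomP f) compA /= (res_comp I _ _ (lexx (val x))).
by rewrite res_id comp1m.
Qed.

End Below.

Section Above.
Hypothesis rho_ge : forall s, (s <= val (rho s))%O.

(** Restriction maps do not lead from [rho s] down to [s], but [R G] has stalk [G (rho s)] at [s],
    so [c] only has to identify [rho (val (rho s))] with [rho s]. *)
Lemma above_gamma_res_iso (G : sheaves (subposet A) V) :
  is_iso (gamma_res V A (R G)).
Proof.
have cN s t (h : (s <= t)%O) :
    res (R G) h ∘ res G (retract_le (rho s)) =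
    res G (retract_le (rho t)) ∘ res (R (E (R G))) h.
  rewrite /= (res_comp G _ _ (le_trans (retract_le (rho s)) (rhoM h))).
  exact/esym/res_comp.
apply: (@gamma_res_iso (R G) (@SheafHom d S V (R (E (R G))) (R G) _ cN)) => [s|x] /=.
  (* The composite restricts from [rho s] to [rho (val (rho s))] and back to [rho s], hence is an
     identity. *)
  rewrite -(gamma_cone (R G) (rho_ge s)) compA /=.
  by rewrite (res_comp G _ _ (lexx _)) res_id comp1m.
by congr (@res _ _ V G _ _ _); exact: bool_irrelevance.
Qed.

(** As [rho] is a left inverse of [val], [E (R G)] is isomorphic to [G]. *)
Lemma restriction_pullback_injective (G : sheaves (subposet A) V) :
  injective_obj G -> injective_obj (E (R G)).
Proof.
have iN (x y : subposet A) (h : (x <= y)%O) :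
    res (E (R G)) h ∘ res G (retract_ge x) = res G (retract_ge y) ∘ res G h.
  by rewrite /= !(res_comp G _ _ (le_trans (retract_ge x) (rhoM h))).
have ii : is_iso (@SheafHom d (subposet A) V G (E (R G)) _ iN : G ~> E (R G)).
  by apply: sheaf_iso_pw => x /=; apply: res_iso_eq; rewrite rhoK.
by have [p [_ ip]] := ii; exact: injective_retract ip.
Qed.

(* [R] is right adjoint to the exact functor of restriction. *)
Lemma above_pullback_injective (G : sheaves (subposet A) V) :
  injective_obj G -> injective_obj (R G).
Proof.
move=> Ginj X Y m f mm.
have fN (x y : subposet A) (h : (x <= y)%O) :
    res G h ∘ (res G (retract_le x) ∘ f (val x)) =
    (res G (retract_le y) ∘ f (val y)) ∘ res (E X) h.
  rewrite compA (res_comp G _ _ (le_trans (retract_le x) h)) -compA /= -(shomP f).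
  by rewrite compA /=; congr (_ ∘ _); exact/esym/res_comp.
have Em := exact_functor_mono (@restriction_exact d S V A) mm.
have [g gE] := Ginj _ _ _ (@SheafHom d (subposet A) V (E X) G _ fN) Em.
have gN s t (h : (s <= t)%O) : res (R G) h ∘ (g (rho s) ∘ res Y (rho_ge s)) =
    (g (rho t) ∘ res Y (rho_ge t)) ∘ res Y h.
  rewrite compA /= (shomP g) -!compA /=; congr (_ ∘ _).
  by rewrite !(res_comp Y _ _ (le_trans (rho_ge s) (rhoM h))).
exists (@SheafHom d S V Y (R G) _ gN); apply: shom_eq => s /=.
rewrite -compA (shomP m) compA.
have -> : g (rho s) ∘ m (val (rho s)) =
    res G (retract_le (rho s)) ∘ f (val (rho s)).
  exact: (congr1 (fun u : sheaf_hom _ _ => u (rho s)) gE).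
rewrite -compA -(shomP f) compA /= (res_comp G _ _ (lexx (rho s))).
by rewrite res_id comp1m.
Qed.

Lemma above_unit_nat (F : sheaves S V) s t (h : (s <= t)%O) :
  res (R (E F)) h ∘ res F (rho_ge s) = res F (rho_ge t) ∘ res F h.
Proof.
by rewrite /= !(res_comp F _ _ (le_trans (rho_ge s) (rhoM h))).
Qed.

Definition above_unit (F : sheaves S V) : F ~> R (E F) :=
  @SheafHom d S V F (R (E F)) _ (@above_unit_nat F).

End Above.

Lemma below_cohomology_res_iso (inj : enough_injectives V) (F : sheaves S V) j :
  (forall s, (val (rho s) <= s)%O) -> is_iso (cohomology_res inj A j F).
Proof.
move=> rho_le; pose I := ires (sheaves_enough_injectives inj) F.
apply: (derived_map_iso _ _ _ _ (iresP I)) => k; first exact: iinj.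
- exact/(below_restriction_injective rho_le)/iinj.
- exact: below_gamma_res_iso.
Qed.

Lemma above_cohomology_res_iso (inj : enough_injectives V) (F : sheaves S V) j
    (rho_ge : forall s, (s <= val (rho s))%O) :
  (forall s, is_iso (res F (rho_ge s))) -> is_iso (cohomology_res inj A j F).
Proof.
move=> Fi; pose I := ires (sheaves_enough_injectives inj) (E F).
have ui : is_iso (above_unit rho_ge F) by exact: sheaf_iso_pw.
(* This resolves [R (E F)]; composing its augmentation with the unit makes it a resolution of
   [F]. *)
have Rres := exact_functor_resolution (pullback_exact rhoM) (iresP I).
apply: (derived_map_iso _ _ _ _ (is_resolution_compiso ui Rres)) => k.
- exact/above_pullback_injective/iinj.
- exact/restriction_pullback_injective/iinj.
- exact: above_gamma_res_iso.
Qed.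

End Retraction.

(** * The retraction that deletes one point *)

Section Deletion.
Context d (S : finPOrderType d) (v a : S) (av : a != v).

Lemma deletion_mem : a \in [set~ v].
Proof. by rewrite !inE. Qed.

(** [insubd] falls back on its default [a] exactly outside the subset, that is, at [v]. *)
Definition deletion_retract (s : S) : subposet [set~ v] :=
  insubd (exist _ a deletion_mem : subposet [set~ v]) s.

Lemma val_deletion_retract s :
  val (deletion_retract s) = if s == v then a else s.
Proof. by rewrite val_insubd !inE if_neg. Qed.

Lemma deletion_retractK : cancel val deletion_retract.
Proof. by move=> x; rewrite /deletion_retract valKd. Qed.

End Deletion.

Theorem theorem1p10 (V : abelian) (injV : enough_injectives V)
    (d : Order.disp_t) (S : finPOrderType d) (F : sheaves S V) (v : S)
    (beat_v : beat F v) (j : nat) :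
  is_iso (cohomology_res injV [set~ v] j F).
Proof.
case: beat_v => [[a [lt_va [a_min res_va]]]|[a [lt_av a_max]]].
- have av : a != v by rewrite gt_eqF.
  have rhoM : {homo deletion_retract av : s t / (s <= t)%O}.
    move=> s t st; suff : (val (deletion_retract av s) <=
      val (deletion_retract av t))%O by [].
    rewrite !val_deletion_retract.
    (* Two cases are not immediate: for [s = v < t], minimality of [a] gives [a <= t]; for
       [s < v = t], [s <= v < a]. *)
    case: (eqVneq s v) st => [->|sv]; case: eqVneq => [-> //|tv] st //.
      by apply: a_min; rewrite lt_neqAle eq_sym tv.
    exact: le_trans st (ltW lt_va).
  have rho_ge s : (s <= val (deletion_retract av s))%O.
    by rewrite val_deletion_retract; case: eqVneq => // ->; exact: ltW.
  have unit_iso s : is_iso (res F (rho_ge s)).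
    (* The proof of the inequality is generalized so that its endpoint can be rewritten. At [v] the
       map is the isomorphism of the upbeat condition; elsewhere both endpoints agree. *)
    move: (rho_ge s); rewrite val_deletion_retract.
    case: eqVneq => [->|_] h; last exact: res_iso_eq.
    by rewrite (bool_irrelevance h (ltW lt_va)).
  exact: (above_cohomology_res_iso rhoM (@deletion_retractK _ _ _ _ av) _ _ unit_iso).
- have av : a != v by rewrite lt_eqF.
  have rhoM : {homo deletion_retract av : s t / (s <= t)%O}.
    move=> s t st; suff : (val (deletion_retract av s) <=
      val (deletion_retract av t))%O by [].
    rewrite !val_deletion_retract.
    (* Dually, [a < v <= t] settles [s = v], and maximality of [a] below [v] settles [t = v]. *)
    case: (eqVneq s v) st => [->|sv]; case: eqVneq => [-> //|tv] st //.
      exact: le_trans (ltW lt_av) st.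
    by apply: a_max; rewrite lt_neqAle sv.
  apply: (below_cohomology_res_iso rhoM (@deletion_retractK _ _ _ _ av)).
  by move=> s; rewrite val_deletion_retract; case: eqVneq => // ->; exact: ltW.
Qed.
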